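(* Suppose $\mu$ is a generalized regular, self-similar measure on $\mathbb{R}$, with support $[0,1]$, that satisfies the asymptotic gap weak separation condition. Then $$\dim_{qA}\mu=\max\left\{\overline{\dim}_{\mathrm{loc}}\,\mu(0),\overline{\dim}_{\mathrm{loc}}\,\mu(1)\right\}=\max\{\overline{\dim}_{\mathrm{loc}}\,\mu(x):x\in\operatorname{supp}\mu\}.$$
   Context: $B(x,r)$ denotes the ball of centre $x$ and radius $r$. Self-similar measures. An iterated function system (IFS) is a finite family $\{S_j\}_{j=0}^{m-1}$ of maps $S_j(x)=r_jx+d_j$ on $\mathbb{R}$ with $0<r_j<1$, $d_j\in\mathbb{R}$. Its attractor is the unique non-empty compact set $F$ with $F=\bigcup_j S_j(F)$; here $F=[0,1]$, and the maps are labelled so that $S_0(0)=0$ and $S_{m-1}(1)=1$. Given probabilities $p_j>0$, $\sum_j p_j=1$, the associated self-similar measure $\mu$ is the unique Borel probability measure with $\mu(E)=\sum_j p_j\mu(S_j^{-1}(E))$ for all Borel sets $E$; its support is $[0,1]$. Put $\lambda=\min_j r_j$. For a finite word $w=w_1\cdots w_n$ put $S_w=S_{w_1}\circ\cdots\circ S_{w_n}$, $r_w=r_{w_1}\cdots r_{w_n}$, $p_w=p_{w_1}\cdots p_{w_n}$, $w^-=w_1\cdots w_{n-1}$. For $n\ge 1$, $\Lambda_n$ is the set of finite words $u$ with $r_u\leq\lambda^n$ and $r_{u^-}>\lambda^n$; $\Lambda_0$ consists of the empty word. Asymptotic gap weak separation condition (AGWSC). There is a non-increasing function $f(n)>0$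 with $(\log f(n))/n\to0$ as $n\to\infty$ such that for all $n$, all $u,w\in\Lambda_n$ and each $z\in\{0,1\}$: if $S_u(z)\neq S_w(z)$ then $|S_u(z)-S_w(z)|\geq f(n)\lambda^n$. A self-similar measure satisfies the AGWSC if its underlying IFS does. Net intervals. For $n\ge1$ let $h_1<\dots<h_{s_n}$ be the elements of $\{S_u(0),S_u(1):u\in\Lambda_n\}$; the net intervals of level $n$ are $[h_j,h_{j+1}]$, $1\le j\le s_n-1$, forming the set $\mathcal F_n$; $[0,1]$ is the unique net interval of level $0$. $\Delta_n(x)$ denotes a net interval of level $n$ containing $x$ (chosen arbitrarily if there are two). For a net interval $\Delta$ of level $n$ put $P_n(\Delta)=\sum_{u\in\Lambda_n,\,S_u[0,1]\supseteq\Delta}p_u$. Generalized regular. Let $\Delta\in\mathcal F_N$ and let $\Delta'\in\mathcal F_{N+n}$ be contained in $\Delta$. If $u\in\Lambda_N$ with $S_u[0,1]\supseteq\Delta$, and $w$ is a word with $uw\in\Lambda_{N+n}$ and $S_{uw}[0,1]\supseteq\Delta'$, then $w$ is called a path of level $n$ of $\Delta$. It is a left-edge path if $S_w(0)=0$ and a right-edge path if $S_w(1)=1$. Let $\Gamma^L_{\Delta,n}$ (resp. $\Gamma^R_{\Delta,n}$) be the sum of $p_w$ over all left-edge (resp. right-edge) paths $w$ of $\Delta$ of level $n$, and $\Gamma_{\Delta,n}=\Gamma^L_{\Delta,n}+\Gamma^R_{\Delta,n}$. For $n\geq1$ and $x\in[0,1]$ let $$Q_n(x)=\sup_{N\in\mathbb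 N}\frac{P_N(\Delta_N(x))}{P_{N+n}(\Delta_{N+n}(x))},$$ where $\Delta_{N+n}(x)$ is a net interval of level $N+n$ contained in $\Delta_N(x)$ and containing $x$ (with $P_{N+n}(\Delta_{N+n}(x))$ minimal if there are two choices), and let $Q_n=\sup_{x\in\operatorname{supp}\mu}Q_n(x)$. The measure $\mu$ (or its weighted IFS) is generalized regular if for each $q>1$, $\lim_{n\to\infty}Q_nq^{-n}\sup_\Delta\Gamma_{\Delta,n}=0$, the supremum being over all net intervals $\Delta$. Dimensions. $\overline{\dim}_{\mathrm{loc}}\,\mu(x)=\limsup_{r\to0}\frac{\log\mu(B(x,r))}{\log r}$ for $x\in\operatorname{supp}\mu$. For $\delta\ge0$ let $H(\delta)$ be the infimum of all $s$ for which there exist $C_1,C_2>0$ such that for all $0<r\leq R^{1+\delta}\leq R\leq C_1$, $\sup_{x\in\operatorname{supp}\mu}\frac{\mu(B(x,R))}{\mu(B(x,r))}\leq C_2(R/r)^s$. Then $\dim_{qA}\mu=\lim_{\delta\to0}H(\delta)$. *)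

(* Defs.v *)
From HB Require Import structures.
From mathcomp Require Import all_boot all_order all_algebra.
From mathcomp Require Import all_classical all_reals all_analysis.

Set Implicit Arguments.
Unset Strict Implicit.
Unset Printing Implicit Defensive.

Import Order.TTheory GRing.Theory Num.Theory.
Import numFieldNormedType.Exports.

Local Open Scope classical_set_scope.
Local Open Scope ring_scope.

(* The number of maps is written [nmaps.+1], so the indices 0 and m - 1 are
   [ord0] and [ord_max]. *)
Record weighted_ifs (R : realType) := WeightedIFS {
  nmaps : nat;
  ratio : 'I_nmaps.+1 -> R;
  trans : 'I_nmaps.+1 -> R;
  weight : 'I_nmaps.+1 -> R;
  ratio_gt0 : forall j, 0 < ratio j;
  ratio_lt1 : forall j, ratio j < 1;
  weight_gt0 : forall j, 0 < weight j;
  weight_sum1 : \sum_j weight j = 1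
}.

Section IFS.
Variables (R : realType) (S : weighted_ifs R).

Definition ifs_map (j : 'I_(nmaps S).+1) (x : R) : R := ratio j * x + trans j.

Definition is_attractor (F : set R) : Prop :=
  [/\ F !=set0, compact F &
      F = \bigcup_(j in [set: 'I_(nmaps S).+1]) (ifs_map j @` F)].

Definition min_ratio : R :=
  \big[Num.min/ratio (ord0 : 'I_(nmaps S).+1)]_(j < (nmaps S).+1) ratio j.

Definition word := seq 'I_(nmaps S).+1.

(* [:: w_1; ...; w_n] acts as S_{w_1} o ... o S_{w_n}. *)
Definition word_map (w : word) : R -> R :=
  foldr (fun j g => ifs_map j \o g) idfun w.

Definition word_ratio (w : word) : R := \prod_(j <- w) ratio j.

Definition word_weight (w : word) : R := \prod_(j <- w) weight j.

Definition word_parent (w : word) : word := take (size w).-1 w.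

Definition level_words (n : nat) : set word :=
  if n is 0 then [set [::]]
  else [set u | word_ratio u <= min_ratio ^+ n /\
                min_ratio ^+ n < word_ratio (word_parent u)].

Definition cell (u : word) : set R := word_map u @` `[0, 1].

Definition asymptotic_gap_wsc : Prop :=
  exists f : nat -> R,
    [/\ forall n, 0 < f n,
        {homo f : m n / (m <= n)%N >-> n <= m},
        (fun n => ln (f n) / n%:R) @ \oo --> (0 : R) &
        forall n u w (z : R), level_words n u -> level_words n w ->
          z = 0 \/ z = 1 -> word_map u z <> word_map w z ->
          f n * min_ratio ^+ n <= `|word_map u z - word_map w z| ].

Definition net_points (n : nat) : set R :=
  [set word_map u 0 | u in level_words n] `|`
  [set word_map u 1 | u in level_words n].

(* The pair (a, b) encodes the interval [a, b]; being a net interval means that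
   a and b are consecutive net points.  At level 0 the net points are 0 and 1,
   so [0, 1] is the only net interval. *)
Definition net_interval (n : nat) (D : R * R) : Prop :=
  [/\ net_points n D.1, net_points n D.2, D.1 < D.2 &
      forall h, net_points n h -> ~ (D.1 < h < D.2)].

Definition itv_of (D : R * R) : set R := `[D.1, D.2].

(* The set of words summed over is finite, so this is a genuine sum; likewise
   for the sums over edge paths below. *)
Definition P_net (n : nat) (D : R * R) : R :=
  \sum_(u \in [set u | level_words n u /\ itv_of D `<=` cell u]) word_weight u.

(* The level N is an argument, since one interval can be a net interval of
   several levels. *)
Definition is_path (N : nat) (D : R * R) (n : nat) (w : word) : Prop :=
  exists D' u,
    [/\ net_interval (N + n) D' /\ itv_of D' `<=` itv_of D,
        level_words N u, itv_of D `<=` cell u,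
        level_words (N + n) (u ++ w) &
        itv_of D' `<=` cell (u ++ w)].

Definition Gamma_left (N : nat) (D : R * R) (n : nat) : R :=
  \sum_(w \in [set w | is_path N D n w /\ word_map w 0 = 0]) word_weight w.

Definition Gamma_right (N : nat) (D : R * R) (n : nat) : R :=
  \sum_(w \in [set w | is_path N D n w /\ word_map w 1 = 1]) word_weight w.

Definition Gamma (N : nat) (D : R * R) (n : nat) : R :=
  Gamma_left N D n + Gamma_right N D n.

Definition Gamma_sup (n : nat) : \bar R :=
  ereal_sup [set y | exists N D, net_interval N D /\ y = (Gamma N D n)%:E].

Definition net_at (N : nat) (x : R) (D : R * R) : Prop :=
  net_interval N D /\ itv_of D x.

Definition net_sub_at (N : nat) (x : R) (D D' : R * R) : Prop :=
  net_at N x D' /\ itv_of D' `<=` itv_of D.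

(* When x is a net point there can be two candidates D for the level-N net
   interval; the supremum runs over both.  The arbitrary choice does not affect
   [Q_sup], as every pair D' inside D is realised at an interior point of D',
   where nothing is left to choose. *)
Definition Q_at (n : nat) (x : R) : \bar R :=
  ereal_sup [set y | exists N D D',
    [/\ net_at N x D,
        net_sub_at (N + n) x D D',
        forall D'', net_sub_at (N + n) x D D'' ->
          P_net (N + n) D' <= P_net (N + n) D'' &
        y = (P_net N D / P_net (N + n) D')%:E]].

End IFS.

Arguments ifs_map {R} S j x.

Section Dimensions.
Variables (R : realType) (mu : probability (measurableTypeR R) R).

Definition msupp : set R := [set x | forall r : R, 0 < r -> (0 < mu (ball x r))%E].

Definition upper_local_dim (x : R) : \bar R :=
  limf_esup (fun r : R => (ln (fine (mu (ball x r))) / ln r)%:E) (0^'+).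

Definition qA_exponent (delta s : R) : Prop :=
  exists C1 C2 : R, [/\ 0 < C1, 0 < C2 &
    forall r rho : R, 0 < r -> r <= rho `^ (1 + delta) ->
      rho `^ (1 + delta) <= rho -> rho <= C1 ->
      (ereal_sup [set (fine (mu (ball x rho)) / fine (mu (ball x r)))%:E
                 | x in msupp] <= (C2 * (rho / r) `^ s)%:E)%E].

Definition qA_H (delta : R) : \bar R :=
  ereal_inf [set s%:E | s in [set s | qA_exponent delta s]].

Definition dim_qA : \bar R := lim (qA_H delta @[delta --> (0 : R)^'+]).

End Dimensions.

Section SelfSimilar.
Variables (R : realType) (S : weighted_ifs R).
Variable mu : probability (measurableTypeR R) R.

Definition self_similar : Prop :=
  forall E : set (measurableTypeR R), measurable E ->
    (mu E = \sum_(j < (nmaps S).+1) (weight j)%:E * mu (ifs_map S j @^-1` E))%E.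

Definition Q_sup (n : nat) : \bar R :=
  ereal_sup [set Q_at S n x | x in msupp mu].

Definition generalized_regular : Prop :=
  forall q : R, 1 < q ->
    (fun n => Q_sup n * (q ^- n)%:E * Gamma_sup S n)%E @ \oo --> (0 : \bar R)%E.

End SelfSimilar.

(* Main.v *)
(* In fact H(delta) = dim(0), the upper local dimension at 0, for every delta > 0:
   H(delta) dominates all upper local dimensions, so only H(delta) <= dim(0) is
   at stake.

   The left-edge paths of level n of [0,1] carry at least the mass of a ball
   around 0 of radius f(n) lambda^n, so generalized regularity bounds the ratios
   P_N(D) / P_{N+n}(D') by lambda^{-n s} for any s > dim(0), up to a
   subexponential factor.  It remains to compare mu(B(x,R)) with P_M of the one
   net interval D at x, where R <= f(M) lambda^M.  By the gap condition all
   cells that meet B(x,R) to the right of D start at one point y, and likewise on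
   the left (nothing is known about differences S_u(0) - S_w(1), so net intervals
   may be very short and only cells are counted).  The mass of the cells starting
   at y is split according to the last level j at which the ancestor of the cell
   still has y in its interior: such ancestors contain both sides of y, and from
   then on the word is an edge path, so regularity, which controls
   Q_n sup Gamma_n, bounds this mass by q^M P_M(D).  The error q^M is absorbed in
   (R/r)^{eps/delta} because r <= R^{1+delta}. *)
Require Import Defs.
From HB Require Import structures.
From mathcomp Require Import all_boot all_order all_algebra.
From mathcomp Require Import all_classical all_reals all_analysis.
From mathcomp Require Import measurable_realfun ring lra.

Import Order.TTheory GRing.Theory Num.Theory.
Import numFieldNormedType.Exports.

Local Open Scope classical_set_scope.
Local Open Scope ring_scope.

(** * Finite sums and finite sets of reals *)

Lemma ler_sum_sub_seq (R : realType) (I : eqType) (s t : seq I) (F : I -> R) :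
  (forall i, 0 <= F i) -> uniq s -> {subset s <= t} ->
  \sum_(i <- s) F i <= \sum_(i <- t) F i.
Proof.
move=> F0; elim: s t => [|x s ih] t /= => [_ _|/andP[xs us] st].
  by rewrite big_nil; apply: sumr_ge0.
have xt : x \in t by apply: st; rewrite mem_head.
rewrite big_cons (perm_big _ (perm_to_rem xt)) big_cons lerD2l; apply: ih => // y ys.
have := st y; rewrite inE ys orbT (perm_mem (perm_to_rem xt)) inE => /(_ isT).
by case: eqP => // yx _; rewrite -yx ys in xs.
Qed.

Lemma finite_set_max (R : realType) (A : set R) :
  finite_set A -> A !=set0 -> exists2 m, A m & ubound A m.
Proof.
move=> /finite_seqP[s ->]; elim: s => [[x]|a s ih _] //.
have [s0|[m ms um]] : [set` s] = set0 \/ exists2 m, [set` s] m & ubound [set` s] m.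
  by have [->|/set0P/ih] := eqVneq [set` s] set0; [left|right].
  exists a => [|x /=]; rewrite /= inE ?eqxx // => /orP[/eqP ->//|xs].
  by have : [set` s] x by []; rewrite s0.
have [am|ma] := leP a m.
  by exists m => [|x /=]; rewrite /= inE ?ms ?orbT // => /orP[/eqP ->|/um].
exists a => [|x /=]; rewrite /= inE ?eqxx // => /orP[/eqP ->//|/um xm].
exact: le_trans xm (ltW ma).
Qed.

Lemma finite_set_min (R : realType) (A : set R) :
  finite_set A -> A !=set0 -> exists2 m, A m & lbound A m.
Proof.
move=> fA [a Aa]; have [||_ [m Am <-] um] := @finite_set_max R (-%R @` A).
- exact: finite_image.
- by exists (- a); exists a.
by exists m => // x Ax; rewrite -lerN2; apply: um; exists x.
Qed.

Lemma mem_enum_fset_set (T : choiceType) (A : set T) x :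
  finite_set A -> (x \in finmap.enum_fset (fset_set A)) = (x \in A).
Proof. by move=> fA; exact: (in_fset_set fA x). Qed.

(** * Words, their affine maps and the levels of the tree of words *)

Section Words.
Context {R : realType} {S : weighted_ifs R}.
Implicit Types (u v w : word S) (n N : nat) (x y : R).

Local Notation lam := (min_ratio S).
Local Notation r_ := (word_ratio).
Local Notation p_ := (word_weight).

Lemma min_ratio_gt0 : 0 < lam.
Proof. by rewrite /min_ratio; apply: lt_bigmin => [|j _]; exact: ratio_gt0. Qed.

Lemma min_ratio_lt1 : lam < 1.
Proof.
apply: le_lt_trans (ratio_lt1 (ord0 : 'I_(nmaps S).+1)).
exact: bigmin_le_id.
Qed.

Lemma min_ratio_exp_gt0 n : 0 < lam ^+ n.
Proof. exact/exprn_gt0/min_ratio_gt0. Qed.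

Lemma min_ratio_exp_le n N : (n <= N)%N -> lam ^+ N <= lam ^+ n.
Proof.
by move=> nN; apply: ler_wiXn2l => //; [exact/ltW/min_ratio_gt0 | exact/ltW/min_ratio_lt1].
Qed.

Lemma word_ratio_cat u v : r_ (u ++ v) = r_ u * r_ v.
Proof. by rewrite /word_ratio big_cat. Qed.

Lemma word_ratio_gt0 u : 0 < r_ u.
Proof. by rewrite /word_ratio; apply: prodr_gt0 => j _; exact: ratio_gt0. Qed.

Lemma word_ratio_le1 u : r_ u <= 1.
Proof.
elim: u => [|j u ih]; first by rewrite /word_ratio big_nil.
rewrite /word_ratio big_cons mulr_ile1 //; last exact/ltW/ratio_lt1.
- exact/ltW/ratio_gt0.
- exact/ltW/word_ratio_gt0.
Qed.

Lemma word_ratio_cat_le u v : r_ (u ++ v) <= r_ u.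
Proof.
by rewrite word_ratio_cat ler_piMr ?word_ratio_le1 // ltW // word_ratio_gt0.
Qed.

Lemma word_ratio_take_le k u : r_ u <= r_ (take k u).
Proof. by rewrite -{1}(cat_take_drop k u) word_ratio_cat_le. Qed.

Lemma word_weight_cat u v : p_ (u ++ v) = p_ u * p_ v.
Proof. by rewrite /word_weight big_cat. Qed.

Lemma word_weight_gt0 u : 0 < p_ u.
Proof. by rewrite /word_weight; apply: prodr_gt0 => j _; exact: weight_gt0. Qed.

Lemma word_map_cat u v x : word_map (u ++ v) x = word_map u (word_map v x).
Proof. by elim: u => //= j u ->. Qed.

Lemma word_mapE u x : word_map u x = r_ u * x + word_map u 0.
Proof.
elim: u x => [|j u ih] x; first by rewrite /word_ratio big_nil /= mul1r addr0.
by rewrite /= ih /ifs_map /word_ratio big_cons mulrDr mulrA addrA.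
Qed.

Lemma word_map_le u x y : (word_map u x <= word_map u y) = (x <= y).
Proof. by rewrite word_mapE (word_mapE u y) lerD2r ler_pM2l ?word_ratio_gt0. Qed.

Lemma word_map_lt u x y : (word_map u x < word_map u y) = (x < y).
Proof. by rewrite !ltNge word_map_le. Qed.

Lemma word_map_eq u x y : (word_map u x == word_map u y) = (x == y).
Proof. by rewrite !eq_le !word_map_le. Qed.

Lemma cellE u : cell u = `[word_map u 0, word_map u 1]%classic.
Proof.
have ru := word_ratio_gt0 u.
apply/seteqP; split => [_ [x /= + <-]|y /=]; rewrite /= !in_itv /=.
  by rewrite !word_map_le.
rewrite (word_mapE u 1) mulr1 => /andP[y0 y1].
exists ((y - word_map u 0) / r_ u); last first.
  by rewrite word_mapE mulrC divfK ?gt_eqF// subrK.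
rewrite /= in_itv /= divr_ge0 ?subr_ge0 ?(ltW ru)//=.
by rewrite ler_pdivrMr// mul1r lerBlDr.
Qed.

Lemma min_ratio_exp_lt1 n : (0 < n)%N -> lam ^+ n < 1.
Proof.
by move=> n0; rewrite exprn_ilt1 ?min_ratio_lt1 ?(ltW min_ratio_gt0)// -lt0n.
Qed.

(** Ratios decrease along prefixes, so the condition on the parent controls every proper prefix.
    Level 0 fits the same pattern because the empty word already has ratio 1. *)
Lemma level_wordsP n u :
  level_words n u <-> r_ u <= lam ^+ n /\
    (forall k, (k < size u)%N -> lam ^+ n < r_ (take k u)).
Proof.
case: n => [|n] /=.
  split=> [->|[_ h]]; first by rewrite /word_ratio big_nil expr0.
  case: u h => // j u /(_ 0%N isT); rewrite take0 expr0.
  by rewrite /word_ratio big_nil ltxx.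
split=> -[un h]; split => //.
  move=> k ku; apply: (lt_le_trans h).
  rewrite /word_parent -(@take_takel _ k (size u).-1) ?word_ratio_take_le//.
  by case: (size u) ku.
rewrite /word_parent; case: u un h => [|j u] un h; last exact: h.
by move: un; rewrite /word_ratio big_nil leNgt min_ratio_exp_lt1.
Qed.

(* The prefix of [v] in level [n]; it is [v] itself if [v] is too short to have one. *)
Definition level_prefix n v : word S :=
  take (find (fun k => r_ (take k v) <= lam ^+ n) (iota 0 (size v).+1)) v.

Lemma level_prefixP n v : exists w, v = level_prefix n v ++ w.
Proof.
by rewrite /level_prefix; set k := find _ _; exists (drop k v); rewrite cat_take_drop.
Qed.

Lemma level_prefix_level n v : r_ v <= lam ^+ n -> level_words n (level_prefix n v).
Proof.
move=> vn; rewrite level_wordsP /level_prefix; set P := fun k => _; set k := find _ _.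
have hasP : has P (iota 0 (size v).+1).
  by apply/hasP; exists (size v); rewrite ?mem_iota ?add0n ?leqnn // /P take_size.
have kv : (k < (size v).+1)%N by rewrite -[X in (_ < X)%N](size_iota 0) -has_find.
split; first by have := nth_find 0%N hasP; rewrite -/k nth_iota.
move=> i; rewrite size_take_min leq_min => /andP[ik iv].
rewrite take_takel ?(ltnW ik)// ltNge.
by have := before_find 0%N ik; rewrite nth_iota ?(ltn_trans ik)// /P add0n => ->.
Qed.

Lemma level_prefix_cat n u w : level_words n u -> level_prefix n (u ++ w) = u.
Proof.
move=> /level_wordsP[un h]; rewrite /level_prefix.
set P := fun k => _; set k := find _ _; suff -> : k = size u by rewrite take_size_cat.
have hs : has P (iota 0 (size (u ++ w)).+1).
  apply/hasP; exists (size u); last by rewrite /P take_size_cat.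
  by rewrite mem_iota add0n /= ltnS size_cat leq_addr.
have kv : (k < (size (u ++ w)).+1)%N by rewrite -[X in (_ < X)%N](size_iota 0) -has_find.
apply/eqP; rewrite eqn_leq; apply/andP; split; rewrite leqNgt; apply/negP => lk.
  have := before_find 0%N lk; rewrite nth_iota ?(ltn_trans lk)// /P add0n.
  by rewrite take_size_cat // un.
have := nth_find 0%N hs; rewrite -/k nth_iota // add0n /P.
by rewrite takel_cat ?(ltnW lk) // leNgt h.
Qed.

Lemma level_prefix_id n u : level_words n u -> level_prefix n u = u.
Proof. by move=> un; rewrite -{1}(cats0 u) level_prefix_cat. Qed.

Lemma level_prefix_le n N u : (n <= N)%N -> level_words N u -> level_words n (level_prefix n u).
Proof.
move=> nN /level_wordsP[uN _]; apply: level_prefix_level.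
exact: le_trans uN (min_ratio_exp_le _ _ nN).
Qed.

Lemma level_prefix_trans n N v : (n <= N)%N -> r_ v <= lam ^+ N ->
  level_prefix n (level_prefix N v) = level_prefix n v.
Proof.
move=> nN vN; have [w vw] := level_prefixP N v.
have [w' pw] := level_prefixP n (level_prefix N v).
have e : v = level_prefix n (level_prefix N v) ++ (w' ++ w) by rewrite catA -pw.
rewrite [in RHS]e level_prefix_cat //.
exact: level_prefix_le nN (level_prefix_level _ _ vN).
Qed.

(** The largest ratio [rho] is below 1 and bounds [word_ratio v] by [rho ^+ size v]. Such a length
    [L] makes levels finite and lets sums over different levels be compared on words of one common
    length. *)
Lemma long_words n : exists L, forall v, (L <= size v)%N -> r_ v <= lam ^+ n.
Proof.
pose rho := \big[Num.max/0]_j Defs.ratio (j : 'I_(nmaps S).+1).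
have rho0 : 0 <= rho by apply: bigmax_ge_id.
have rho1 : rho < 1 by apply: bigmax_lt => // j _; exact: ratio_lt1.
have rv v : r_ v <= rho ^+ size v.
  elim: v => [|j v ih]; first by rewrite /word_ratio big_nil expr0.
  rewrite /word_ratio big_cons exprS ler_pM //; first exact/ltW/ratio_gt0.
    exact/ltW/word_ratio_gt0.
  exact: le_bigmax.
have /cvgrPdist_lt/(_ _ (min_ratio_exp_gt0 n)) : (fun k => rho ^+ k) @ \oo --> (0 : R).
  by apply: cvg_expr; rewrite ger0_norm.
move=> [L _ hL]; exists L => v Lv; apply: (le_trans (rv v)).
have := hL _ Lv; rewrite /= sub0r normrN ger0_norm ?exprn_ge0 //; exact: ltW.
Qed.

Lemma size_level_words n L : (forall v, (L <= size v)%N -> r_ v <= lam ^+ n) ->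
  forall u, level_words n u -> (size u <= L)%N.
Proof.
move=> hL u /level_wordsP[_ h]; rewrite leqNgt; apply/negP => Lu.
have := h _ Lu; rewrite ltNge hL // size_take_min (minn_idPl _) //; exact: ltnW.
Qed.

(** * Finiteness of levels, and masses of sets of level words *)

Fixpoint all_words k : seq (word S) :=
  if k is k'.+1 then
    [seq j :: w | j <- enum 'I_(nmaps S).+1, w <- all_words k']
  else [:: [::]].

Lemma mem_all_words k w : (w \in all_words k) = (size w == k).
Proof.
elim: k w => [|k ih] w; first by rewrite inE; case: w.
case: w => [|j w] /=.
  by apply/negP => /allpairsP[[i v]] /= [].
rewrite eqSS -ih; apply/allpairsP/idP => [[[i v]] /= [_ vk [_ ->]] //|wk].
by exists (j, w); rewrite mem_enum.
Qed.

Lemma uniq_all_words k : uniq (all_words k).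
Proof.
elim: k => //= k ih; apply: allpairs_uniq; rewrite ?enum_uniq //.
by move=> [i v] [j w] _ _ [-> ->].
Qed.

Lemma finite_level_words n : finite_set (level_words n : set (word S)).
Proof.
have [L hL] := long_words n.
pose s := flatten [seq all_words k | k <- iota 0 L.+1].
apply: (@sub_finite_set _ _ [set` s]); last exact: finite_seq.
move=> u /(size_level_words _ _ hL) uL /=.
apply/flatten_mapP; exists (size u); rewrite ?mem_iota ?mem_all_words //=.
Qed.

(** Finitely additive mass on the tree of words: a word shares its value among its children. It is
    applied to the weights and to the share of each word in the measure of a fixed set. *)
Definition word_additive (phi : word S -> R) := forall u, phi u = \sum_j phi (rcons u j).

Lemma word_additive_sum phi k u : word_additive phi -> phi u = \sum_(w <- all_words k) phi (u ++ w).
Proof.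
move=> h; elim: k u => [|k ih] u; first by rewrite big_seq1 cats0.
rewrite h /= big_allpairs_dep big_enum; apply: eq_bigr => j _.
by rewrite ih; apply: eq_bigr => w _; rewrite cat_rcons.
Qed.

(** Each word of length [L] has exactly one prefix in level [n], so grouping the words of length [L]
    by that prefix recovers the sum over the level. *)
Lemma word_additive_level phi n L (A : set (word S)) : word_additive phi ->
  (forall v, (L <= size v)%N -> r_ v <= lam ^+ n) ->
  \sum_(u \in [set u | level_words n u /\ A u]) phi u =
  \sum_(v <- all_words L | `[< A (level_prefix n v) >]) phi v.
Proof.
move=> h hL.
have fA : finite_set [set u | level_words n u /\ A u].
  by apply: sub_finite_set (finite_level_words n) => u [].
rewrite fsbig_finite //=; set s := finmap.enum_fset _.
have ms u : u \in s <-> level_words n u /\ A u.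
  by rewrite /s mem_enum_fset_set // inE.
transitivity (\sum_(u <- s) \sum_(v <- all_words L | u == level_prefix n v) phi v).
  rewrite big_seq [RHS]big_seq; apply: eq_bigr => u /ms[un _].
  have uL := size_level_words _ _ hL _ un.
  rewrite (word_additive_sum _ (L - size u) u h) -(big_map (cat u) xpredT) -[RHS]big_filter.
  apply: perm_big; apply: uniq_perm.
  - by rewrite map_inj_uniq ?uniq_all_words // => x y /eqP; rewrite eqseq_cat // eqxx => /eqP.
  - by rewrite filter_uniq // uniq_all_words.
  move=> v; rewrite mem_filter mem_all_words; apply/mapP/andP.
    move=> [w]; rewrite mem_all_words => /eqP wL ->.
    by rewrite level_prefix_cat // eqxx size_cat wL subnKC.
  move=> [/eqP uv /eqP vL]; have [w vw] := level_prefixP n v.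
  exists w; last by rewrite {1}vw -uv.
  by rewrite mem_all_words -vL {1}vw size_cat -uv addKn.
rewrite (exchange_big_dep xpredT) //= [RHS]big_mkcond /=.
rewrite big_seq [RHS]big_seq; apply: eq_bigr => v; rewrite mem_all_words => /eqP vL.
have pn : level_words n (level_prefix n v) by apply: level_prefix_level; rewrite hL ?vL.
case: asboolP => [Av|nAv].
  by rewrite -big_filter filter_pred1_uniq ?big_seq1 //; [exact: finmap.fset_uniq | exact/ms].
rewrite big_seq_cond big1 // => u /andP[/ms[_ Au] /eqP uv].
by rewrite uv in Au.
Qed.

Lemma weight_word_additive : word_additive (@word_weight R S).
Proof.
move=> u; rewrite -{1}(mulr1 (p_ u)) -(weight_sum1 S) mulr_sumr.
by apply: eq_bigr => j _; rewrite -cats1 word_weight_cat /word_weight big_seq1.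
Qed.

Definition level_mass n (A : set (word S)) : R :=
  \sum_(u \in [set u | level_words n u /\ A u]) p_ u.

Lemma level_mass_ge0 n A : 0 <= level_mass n A.
Proof.
rewrite /level_mass; apply: sumr_ge0 => u _; exact/ltW/word_weight_gt0.
Qed.

(** Both masses become sums over the words of one length, where the inequality holds term by
    term. *)
Lemma le_level_mass n N (A B : set (word S)) : (n <= N)%N ->
  (forall u, level_words N u -> B u -> A (level_prefix n u)) ->
  level_mass N B <= level_mass n A.
Proof.
move=> nN BA; have [L1 h1] := long_words n; have [L2 h2] := long_words N.
rewrite /level_mass.
rewrite (word_additive_level _ n (maxn L1 L2) _ weight_word_additive); last first.
  by move=> v; rewrite geq_max => /andP[+ _]; exact: h1.
rewrite (word_additive_level _ N (maxn L1 L2) _ weight_word_additive); last first.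
  by move=> v; rewrite geq_max => /andP[_ +]; exact: h2.
rewrite big_mkcond [leRHS]big_mkcond big_seq [leRHS]big_seq; apply: ler_sum => v.
rewrite mem_all_words => /eqP vL.
have pN : level_words N (level_prefix N v).
  by apply: level_prefix_level; rewrite h2 // vL leq_maxr.
case: asboolP => [/(BA _ pN)|_]; last first.
  by case: asboolP => _; rewrite // ltW // word_weight_gt0.
rewrite level_prefix_trans ?h2 ?vL ?leq_maxr //.
by move=> Av; case: asboolP.
Qed.

Lemma level_mass_bigcup n k (A : set (word S)) (B : 'I_k -> set (word S)) :
  (forall u, level_words n u -> A u -> exists i, B i u) ->
  level_mass n A <= \sum_i level_mass n (B i).
Proof.
move=> AB; have [L hL] := long_words n.
have massE C : level_mass n C =
    \sum_(v <- all_words L) (if `[< C (level_prefix n v) >] then p_ v else 0).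
  by rewrite -big_mkcond -(word_additive_level _ _ _ _ weight_word_additive hL).
rewrite massE (eq_bigr _ (fun i _ => massE (B i))).
rewrite exchange_big /= big_seq [leRHS]big_seq; apply: ler_sum => v.
rewrite mem_all_words => /eqP vL.
have p0 w : 0 <= p_ w by exact/ltW/word_weight_gt0.
case: asboolP => [/AB[|i Bi]|_].
- by apply: level_prefix_level; rewrite hL ?vL.
- rewrite (bigD1 i) //= asboolT // lerDl; apply: sumr_ge0 => l _.
  by case: ifP.
- by apply: sumr_ge0 => l _; case: ifP.
Qed.

Lemma level_massU n (A B C : set (word S)) :
  (forall u, level_words n u -> A u -> B u \/ C u) ->
  level_mass n A <= level_mass n B + level_mass n C.
Proof.
move=> ABC.
have := @level_mass_bigcup n 2 A (fun i => if i == ord0 then B else C).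
rewrite !big_ord_recl big_ord0 addr0 /=; apply => u un /(ABC u un)[Bu|Cu].
  by exists ord0.
by exists (lift ord0 ord0).
Qed.

Lemma level_mass_concat n N (A B W : set (word S)) : finite_set W ->
  (forall u, level_words N u -> A u ->
    exists a w, [/\ u = a ++ w, level_words n a, B a & W w]) ->
  level_mass N A <= level_mass n B * \sum_(w \in W) p_ w.
Proof.
move=> fW AB; rewrite /level_mass.
have fA : finite_set [set u | level_words N u /\ A u].
  by apply: sub_finite_set (finite_level_words N) => u [].
have fB : finite_set [set u | level_words n u /\ B u].
  by apply: sub_finite_set (finite_level_words n) => u [].
rewrite !fsbig_finite //= mulr_suml.
under [leRHS]eq_bigr => a _.
  rewrite mulr_sumr; under eq_bigr => w _ do rewrite -word_weight_cat; over.
rewrite -(big_allpairs_dep (h := fun a w : word S => a ++ w)).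
apply: ler_sum_sub_seq => [u||u].
- exact/ltW/word_weight_gt0.
- exact: finmap.fset_uniq.
rewrite mem_enum_fset_set // inE => -[uN /(AB _ uN)[a [w [-> an Ba Ww]]]].
apply/allpairsP; exists (a, w).
by split => //=; rewrite mem_enum_fset_set // inE.
Qed.

End Words.


(** * Scales, subexponential sequences and the choice of a small exponent *)

Lemma exists_pow_bracket (R : realType) (t z : R) : 0 < t < 1 -> 0 < z <= 1 ->
  exists n, t ^+ n.+1 < z <= t ^+ n.
Proof.
move=> /andP[t0 t1] /andP[z0 z1].
have [N0 _ hN] : \forall n \near \oo, t ^+ n < z.
  have : (fun n => t ^+ n) @ \oo --> (0 : R) by apply: cvg_expr; rewrite ger0_norm // ltW.
  move=> /cvgrPdist_lt/(_ _ z0); apply: filterS => n.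
  by rewrite sub0r normrN ger0_norm // exprn_ge0 // ltW.
have ex : exists n, t ^+ n.+1 < z by exists N0; apply: hN; rewrite /= leqnSn.
case: (ex_minnP ex) => n nz hmin; exists n; rewrite nz /=.
case: n nz hmin => [|n] nz hmin; first by rewrite expr0.
by rewrite leNgt; apply/negP => /hmin; rewrite ltnn.
Qed.

(** Past some [N] the limit gives [ln (f n) > - n ln q]; before [N], monotonicity gives
    [f n >= f N]. Hence the constant is the minimum of 1 and [f N]. *)
Lemma subexponential_lower_bound (R : realType) (f : nat -> R) (q : R) :
  (forall n, 0 < f n) -> {homo f : m n / (m <= n)%N >-> n <= m} ->
  (fun n => ln (f n) / n%:R) @ \oo --> (0 : R) -> 1 < q ->
  exists2 c : R, 0 < c <= 1 & forall n, c / q ^+ n <= f n.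
Proof.
move=> f0 fdec fcvg q1; have q0 : 0 < q by lra.
have lnq : 0 < ln q by apply: ln_gt0.
have /cvgrPdist_lt/(_ _ lnq)[N _ hN] := fcvg.
exists (Num.min 1 (f N)) => [|n]; first by rewrite lt_min ltr01 f0 ge_min lexx.
have qn1 : 1 <= q ^+ n by rewrite exprn_ege1 // ltW.
have qn0 : 0 < q ^+ n by rewrite exprn_gt0.
have [nN|Nn] := leqP n N.
  rewrite ler_pdivrMr // ge_min; apply/orP; right.
  by rewrite (le_trans (fdec _ _ nN)) // ler_peMr // ltW.
have n0 : (0 : R) < n%:R by rewrite ltr0n (leq_trans _ Nn).
have := hN n (ltnW Nn); rewrite /= sub0r normrN ltr_norml => /andP[+ _].
rewrite ltr_pdivlMr // mulNr mulr_natr -lnXn // -lnV ?posrE //.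
rewrite ltr_ln ?posrE ?invr_gt0 // => /ltW; apply: le_trans.
by rewrite ler_piMl ?ge_min ?lexx // invr_ge0 ltW.
Qed.

(** The left side, which is the exponent of [R / r] in the final estimate, tends to [s] as [eps]
    tends to 0. *)
Lemma exists_small_exponent (R : realType) (delta s eta : R) :
  0 < delta -> 0 <= s -> 0 < eta ->
  exists2 eps, 0 < eps &
    eps / delta + (1 + eps / delta) * (eps + (1 + eps) * s) <= s + eta.
Proof.
move=> delta0 s0 eta0; have : 0 < delta^-1 by rewrite invr_gt0.
(* For [eps <= 1] the left side exceeds [s] by at most [eps * A]. *)
set d := delta^-1 => d0; pose A := d + 1 + s + d * (1 + 2 * s).
have A0 : 0 < A by rewrite /A; nra.
exists (Num.min 1 (eta / A)); first by rewrite lt_min ltr01 divr_gt0.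
set eps := Num.min _ _.
have eps0 : 0 < eps by rewrite lt_min ltr01 divr_gt0.
have eps1 : eps <= 1 by rewrite ge_min lexx.
have epsA : eps * A <= eta by rewrite -ler_pdivlMr // ge_min lexx orbT.
have h1 : eps + (1 + eps) * s <= 1 + 2 * s by nra.
have h2 : eps * d * (eps + (1 + eps) * s) <= eps * d * (1 + 2 * s).
  by rewrite ler_wpM2l // mulr_ge0 // ltW.
move: epsA h2; rewrite /A; nra.
Qed.

(** * Support, upper local dimension and exponents of a probability measure *)

Section Dimension.
Context {R : realType} {mu : probability (measurableTypeR R) R}.
Implicit Types (x y r : R) (E F : set (measurableTypeR R)).

Lemma fine_mu_ge0 E : 0 <= fine (mu E).
Proof. exact: fine_ge0. Qed.

Lemma fine_mu_le1 E : measurable E -> fine (mu E) <= 1.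
Proof.
by move=> mE; rewrite -lee_fin fineK ?probability_le1 ?fin_num_measure.
Qed.

Lemma fine_mu_le E F : measurable E -> measurable F -> E `<=` F ->
  fine (mu E) <= fine (mu F).
Proof.
move=> mE mF EF; apply: fine_le; rewrite ?fin_num_measure //.
by apply: le_measure; rewrite ?inE.
Qed.

Lemma measurableR_ball x (r : R) : measurable (ball x r : set (measurableTypeR R)).
Proof. by rewrite ball_itv; exact: measurable_itv. Qed.

(** Countably many null balls, with rational centres and radii [1 / (k + 1)], cover the complement
    of the support. *)
Lemma msuppC_null : mu.-negligible (~` msupp mu).
Proof.
pose B (p : rat * nat) : set (measurableTypeR R) := ball (ratr p.1 : R) p.2.+1%:R^-1.
pose F (k : nat) := if unpickle k is Some p then if mu (B p) == 0%E then B p else set0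
  else set0.
apply: (@negligibleS _ _ _ mu (\bigcup_k F k)); last first.
  apply: negligible_bigcup => k; rewrite /F; case: unpickle => [p|]; last exact: negligible_set0.
  case: eqP => [B0|_]; last exact: negligible_set0.
  by exists (B p); split=> //; exact: measurableR_ball.
move=> x; rewrite /msupp /= => /existsNP[r /not_implyP[r0 /negP]].
rewrite lt0e measure_ge0 andbT negbK => /eqP xr0.
(* The radius [1 / (i + 1)] is below [r / 2], so a ball of that radius that contains [x] lies in the
   null ball around [x]. *)
pose i := Num.truncn (2 / r).
have i0 : 0 < i.+1%:R^-1 :> R by rewrite invr_gt0 ltr0n.
have ir : 2 * i.+1%:R^-1 < r.
  rewrite ltr_pdivrMr ?ltr0n // mulrC -ltr_pdivrMr //.
  by exact: Num.Theory.truncnS_gt.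
have [|p] := @rat_in_itvoo R (x - i.+1%:R^-1) (x + i.+1%:R^-1).
  by rewrite ltrBlDr -addrA ltrDl addr_gt0.
rewrite in_itv /= => /andP[px xp].
have BE : B (p, i) = ball (ratr p : R) i.+1%:R^-1 by [].
move: i0 ir px xp BE; set e := i.+1%:R^-1 => i0 ir px xp BE.
have xB : B (p, i) x by rewrite BE /ball /= ltr_distlC; apply/andP; split; lra.
have B0 : mu (B (p, i)) == 0%E.
  rewrite -measure_le0 -xr0; apply: le_measure; rewrite ?inE.
  - exact: measurableR_ball.
  - exact: measurableR_ball.
  - by move=> z; rewrite BE /ball /= !ltr_distlC => /andP[z1 z2]; apply/andP; split; lra.
exists (pickle (p, i)); first exact: I.
rewrite /F; have -> := pickleK (p, i).
by rewrite B0.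
Qed.

Lemma msupp_ball_gt0 x r : msupp mu x -> 0 < r -> 0 < fine (mu (ball x r)).
Proof.
move=> xs r0; apply: fine_gt0; rewrite xs //= -ge0_fin_numE //.
by rewrite fin_num_measure //; exact: measurableR_ball.
Qed.

(** Keep the large radius fixed at [R0] and let [r] tend to 0: the exponent inequality becomes a
    lower bound for the mass of [ball x r], and its constants vanish after division by [ln r]. *)
Lemma upper_local_dim_le_exponent delta s x : 0 < delta -> qA_exponent mu delta s ->
  msupp mu x -> (upper_local_dim mu x <= s%:E)%E.
Proof.
move=> delta0 [C1 [C2 [C10 C20 h]]] xs; apply/lee_addgt0Pr => e e0.
pose R0 := Num.min C1 (1 / 2).
have R00 : 0 < R0 by rewrite lt_min C10 divr_gt0.
have R0C : R0 <= C1 by rewrite ge_min lexx.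
have R01 : R0 < 1 by rewrite gt_min; apply/orP; right; lra.
have R0d : R0 `^ (1 + delta) <= R0.
  rewrite -[leRHS]powRr1 ?(ltW R00) // -ler_ln ?posrE ?powR_gt0 //.
  have : ln R0 < 0 by rewrite ln_lt0 // R00.
  rewrite !ln_powR; nra.
have R0d0 : 0 < R0 `^ (1 + delta) by rewrite powR_gt0.
(* The inequality reads [ln (mu (ball x r)) >= K + s * ln r]; for [r < expR (K / e)] the right side
   is at least [(s + e) * ln r]. *)
pose K := ln (fine (mu (ball x R0))) - ln C2 - s * ln R0.
pose r1 := Num.min (R0 `^ (1 + delta)) (expR (K / e)).
have r10 : 0 < r1 by rewrite lt_min R0d0 expR_gt0.
pose V : set R := [set r | 0 < r < r1].
apply: (@le_trans _ _ (ereal_sup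
    [set (ln (fine (mu (ball x r))) / ln r)%:E | r in V])).
  apply: ereal_inf_lbound; exists V => //.
  near=> r; apply/andP; split; first by near: r; exact: nbhs_right_gt.
  by near: r; exact: nbhs_right_lt.
apply: ge_ereal_sup => _ [r /andP[r0 rr1] <-]; rewrite -EFinD lee_fin.
move: rr1; rewrite lt_min => /andP[rR rK].
have lnr : ln r < 0 by rewrite ln_lt0 // r0; lra.
have mR := msupp_ball_gt0 _ _ xs R00; have mr := msupp_ball_gt0 _ _ xs r0.
have := h r R0 r0 (ltW rR) R0d R0C.
move=> /(le_trans (ereal_sup_ubound _)) => /(_ _ (ex_intro2 _ _ x xs erefl)).
rewrite lee_fin -ler_ln ?posrE ?divr_gt0 ?mulr_gt0 ?powR_gt0 ?divr_gt0 //.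
rewrite ln_div ?posrE // lnM ?posrE ?powR_gt0 ?divr_gt0 // ln_powR ln_div ?posrE // => hl.
rewrite ler_ndivrMr //.
have : ln r < K / e by rewrite -(expRK (K / e)) ltr_ln ?posrE ?expR_gt0.
rewrite ltr_pdivlMr // /K; nra.
Unshelve. all: by end_near. Qed.

(** For radii below some [rho0] the quotient of logarithms is below [s], so the mass is at least
    [r ^ s]. Applying this at [r1 * r] instead of [r] covers all [r <= 1], at the price of the
    constant [r1 ^ s]. The sign of [s] follows because the quotient at [r1] is nonnegative. *)
Lemma upper_local_dim_lt x s : msupp mu x -> (upper_local_dim mu x < s%:E)%E ->
  0 <= s /\ exists2 c, 0 < c & forall r, 0 < r <= 1 -> c * r `^ s <= fine (mu (ball x r)).
Proof.
move=> xs /ereal_inf_lt[_ [V V0 <-] Vs].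
have [rho0 rho00 hV] : exists2 rho0 : R, 0 < rho0 & forall r, 0 < r < rho0 -> V r.
  move: V0 => [e /= e0 he]; exists e => // r /andP[r0 re].
  by apply: he => //=; rewrite /ball /= sub0r normrN gtr0_norm.
have bound r : 0 < r < rho0 -> ln (fine (mu (ball x r))) / ln r < s.
  move=> /hV Vr; rewrite -lte_fin; apply: le_lt_trans Vs.
  by apply: ereal_sup_ubound; exists r.
pose r1 := Num.min rho0 1 / 2.
have r1rho : 0 < r1 < rho0.
  have : Num.min rho0 1 <= rho0 by rewrite ge_min lexx.
  have : 0 < Num.min rho0 1 by rewrite lt_min rho00 ltr01.
  rewrite /r1; lra.
have r11 : r1 < 1.
  have : Num.min rho0 1 <= 1 by rewrite ge_min lexx orbT.
  rewrite /r1; lra.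
have /andP[r10 _] := r1rho.
have s0 : 0 <= s.
  apply: ltW; apply: le_lt_trans (bound _ r1rho).
  rewrite mulr_le0 // ?invr_le0; last by rewrite ln_le0 // ltW.
  by rewrite ln_le0 // fine_mu_le1 //; exact: measurableR_ball.
split=> //; exists (r1 `^ s); first by rewrite powR_gt0.
move=> r /andP[r0 r_1]; rewrite -powRM ?(ltW r10) ?(ltW r0) //.
have rr : 0 < r1 * r < rho0 by rewrite mulr_gt0 //=; nra.
have rr1 : 0 < r1 * r < 1 by rewrite mulr_gt0 //=; nra.
have /andP[rr0 _] := rr; have lnrr := ln_lt0 rr1.
have mr := msupp_ball_gt0 _ _ xs rr0.
apply: (@le_trans _ _ (fine (mu (ball x (r1 * r))))).
  rewrite -ler_ln ?posrE ?powR_gt0 // ln_powR.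
  by have := bound _ rr; rewrite ltr_ndivrMr // => /ltW.
apply: fine_mu_le; [exact: measurableR_ball|exact: measurableR_ball|].
move=> z; apply: le_ball; nra.
Qed.

Lemma qA_H_le delta s : (forall s', s < s' -> qA_exponent mu delta s') ->
  (qA_H mu delta <= s%:E)%E.
Proof.
move=> h; apply/lee_addgt0Pr => e e0; apply: ereal_inf_lbound.
by exists (s + e) => //; apply: h; rewrite ltrDl.
Qed.

End Dimension.

(** * Arithmetic of real powers *)

Lemma powRXn (R : realType) (x e : R) n : 0 <= x -> (x `^ e) ^+ n = (x ^+ n) `^ e.
Proof.
move=> x0; rewrite -(powR_mulrn n (powR_ge0 _ _)) -(powR_mulrn n x0).
by rewrite -powRrM mulrC powRrM.
Qed.

(** Meant for [a = lam^-M], [b = lam^-n] and [X = rho / r]. Bounding [a] by a power of [X] turns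
    both factors into powers of [X], whose exponents add up to the left side of the condition on
    [s']. *)
Lemma powR_combine (R : realType) (a b X K eps delta s s' : R) :
  0 < eps -> 0 < delta -> 0 <= s -> 0 < K -> 1 <= X ->
  0 <= a <= X `^ delta^-1 -> 0 <= b <= K * X * a `^ eps ->
  eps / delta + (1 + eps / delta) * (eps + (1 + eps) * s) <= s' ->
  a `^ eps * b `^ (eps + (1 + eps) * s) <= K `^ (eps + (1 + eps) * s) * X `^ s'.
Proof.
move=> eps0 delta0 s0 K0 X1 /andP[a0 aX] /andP[b0 bX] le_s'.
have X0 : 0 < X by lra.
set sigma := eps + (1 + eps) * s; have sigma0 : 0 <= sigma by rewrite /sigma; nra.
have aY : a `^ eps <= X `^ (eps / delta).
  by rewrite [eps / _]mulrC powRrM ge0_ler_powR ?nnegrE ?powR_ge0 // ltW.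
have bY : b <= K * X `^ (1 + eps / delta).
  rewrite powRD ?(gt_eqF X0) ?implybT // powRr1 ?(ltW X0) // mulrA.
  by apply: (le_trans bX); rewrite ler_wpM2l // mulr_ge0 // ltW.
apply: (@le_trans _ _ (X `^ (eps / delta) * (K * X `^ (1 + eps / delta)) `^ sigma)).
  apply: ler_pM; rewrite ?powR_ge0 // ge0_ler_powR // nnegrE //.
  by rewrite mulr_ge0 ?powR_ge0 // ltW.
rewrite powRM ?powR_ge0 ?(ltW K0) // mulrCA ler_pM2l ?powR_gt0 // -powRrM -powRD; last first.
  by rewrite (gt_eqF X0) implybT.
exact: ler_powR.
Qed.


(** * Cells of a system with attractor [0,1] *)

Section QuasiAssouad.
Context {R : realType} {S : weighted_ifs R}.
Variable mu : probability (measurableTypeR R) R.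
Hypothesis attractor01 : is_attractor S `[0, 1]%classic.
Hypothesis label_first : ifs_map S ord0 0 = 0.
Hypothesis label_last : ifs_map S ord_max 1 = 1.
Hypothesis mu_self_similar : self_similar S mu.
Hypothesis mu_supp : msupp mu = `[0, 1]%classic.
Hypothesis mu_regular : generalized_regular S mu.
Implicit Types (u v w : word S) (n N : nat) (x y : R) (D : R * R).
Implicit Types (E : set (measurableTypeR R)).

Local Notation lam := (min_ratio S).
Local Notation r_ := (word_ratio).
Local Notation p_ := (word_weight).

Lemma ifs_map_01 j x : 0 <= x <= 1 -> 0 <= ifs_map S j x <= 1.
Proof.
move=> x01; have [_ _ e] := attractor01.
have : `[0, 1]%classic (ifs_map S j x) by rewrite e; exists j => //; exists x; rewrite //= in_itv.
by rewrite /= in_itv.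
Qed.

Lemma word_map_01 u x : 0 <= x <= 1 -> 0 <= word_map u x <= 1.
Proof. by move=> x01; elim: u => //= j u ih; apply: ifs_map_01. Qed.

Lemma word_map0_ge0 u : 0 <= word_map u 0.
Proof. by have /andP[] := word_map_01 u 0 (etrans (congr2 andb (lexx _) (ler01)) erefl). Qed.

Lemma word_map1_le1 u : word_map u 1 <= 1.
Proof. by have /andP[] := word_map_01 u 1 (etrans (congr2 andb ler01 (lexx _)) erefl). Qed.

Lemma word_map01_lt u : word_map u 0 < word_map u 1.
Proof. by rewrite word_map_lt. Qed.

Lemma word_map_prefix0 u w : word_map u 0 <= word_map (u ++ w) 0.
Proof. by rewrite word_map_cat word_map_le word_map0_ge0. Qed.

Lemma word_map_prefix1 u w : word_map (u ++ w) 1 <= word_map u 1.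
Proof. by rewrite word_map_cat word_map_le word_map1_le1. Qed.

Lemma long_cover k x : 0 <= x <= 1 ->
  exists v : word S, size v = k /\ word_map v 0 <= x <= word_map v 1.
Proof.
elim: k x => [|k ih] x x01; first by exists [::].
have [_ _ e] := attractor01.
have : `[0, 1]%classic x by rewrite /= in_itv.
rewrite e => -[j _ [y /=]]; rewrite in_itv /= => /ih[v [vk vy]] <-.
exists (j :: v); split; first by rewrite /= vk.
by rewrite /= /ifs_map !lerD2r !ler_pM2l ?ratio_gt0.
Qed.

Lemma level_cover n x : 0 <= x <= 1 ->
  exists2 u : word S, level_words n u & word_map u 0 <= x <= word_map u 1.
Proof.
have [L hL] := @long_words R S n => /(long_cover L)[v [vL /andP[v0 v1]]].
exists (level_prefix n v); first by apply: level_prefix_level; rewrite hL ?vL.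
have [w vw] := level_prefixP n v; rewrite vw in v0 v1.
by rewrite (le_trans (word_map_prefix0 _ w)) // (le_trans v1) // word_map_prefix1.
Qed.

Lemma word_map_nseq0 k : word_map (nseq k ord0 : word S) 0 = 0.
Proof. by elim: k => //= k ->. Qed.

Lemma word_map_nseq1 k : word_map (nseq k ord_max : word S) 1 = 1.
Proof. by elim: k => //= k ->. Qed.

(** Append many copies of [j] and cut at level [N]; what remains after [u] is still constant. With
    the first or the last letter this preserves an endpoint of the cell. *)
Lemma level_extend n N u j : (n <= N)%N -> level_words n u ->
  exists k, level_words N (u ++ nseq k j).
Proof.
move=> nN un; have [L hL] := @long_words R S N.
pose v := u ++ nseq L j; have vN : r_ v <= lam ^+ N.
  by apply: hL; rewrite size_cat size_nseq leq_addl.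
have tN := level_prefix_level _ _ vN.
have [w' vt] := level_prefixP N v.
have [w] := level_prefixP n (level_prefix N v).
rewrite level_prefix_trans // (level_prefix_cat n u)// => tE.
exists (size w); suff <- : w = nseq (size w) j by rewrite -tE.
have : v = u ++ (w ++ w') by rewrite catA -tE.
move=> /(congr1 (drop (size u))); rewrite !drop_size_cat // => e.
apply/all_pred1P; have : all (pred1 j) (w ++ w') by rewrite -e all_pred1_nseq.
by rewrite all_cat => /andP[].
Qed.

(** * Net points and net intervals *)

Lemma net_pointsP n h : net_points S n h <->
  exists u : word S, level_words n u /\ (word_map u 0 = h \/ word_map u 1 = h).
Proof.
split=> [[[u un <-]|[u un <-]]|[u [un [e|e]]]].
- by exists u; split=> //; left.
- by exists u; split=> //; right.
- by left; exists u.
- by right; exists u.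
Qed.

(** [S_0] fixes 0 and the last map fixes 1, so an endpoint of a cell is also an endpoint of one of
    its descendants at any deeper level. *)
Lemma net_points_sub n N h : (n <= N)%N -> net_points S n h -> net_points S N h.
Proof.
move=> nN [[u un <-]|[u un <-]].
  have [k uN] := level_extend _ _ _ ord0 nN un.
  by left; exists (u ++ nseq k ord0); rewrite // word_map_cat word_map_nseq0.
have [k uN] := level_extend _ _ _ ord_max nN un.
by right; exists (u ++ nseq k ord_max); rewrite // word_map_cat word_map_nseq1.
Qed.

Lemma net_points0 n : net_points S n 0.
Proof. by apply: (net_points_sub 0) => //; left; exists [::]. Qed.

Lemma net_points1 n : net_points S n 1.
Proof. by apply: (net_points_sub 0) => //; right; exists [::]. Qed.

Lemma net_points_01 n h : net_points S n h -> 0 <= h <= 1.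
Proof. by move=> /net_pointsP[u [_ [<-|<-]]]; rewrite word_map_01 // ?lexx ler01. Qed.

Lemma finite_net_points n : finite_set (net_points S n).
Proof. by rewrite finite_setU; split; apply: finite_image; exact: finite_level_words. Qed.

(** The half-open condition selects the neighbour to the right of [x] when [x] is a net point;
    [net_interval_left] selects the other one. *)
Lemma net_interval_right n x : 0 <= x < 1 ->
  exists2 D, net_interval S n D & D.1 <= x < D.2.
Proof.
move=> /andP[x0 x1].
have [||a [an ax] ua] := @finite_set_max R [set h | net_points S n h /\ h <= x].
- by apply: sub_finite_set (finite_net_points n) => h [].
- by exists 0; split=> //; exact: net_points0.
have [||b [bn bx] ub] := @finite_set_min R [set h | net_points S n h /\ x < h].
- by apply: sub_finite_set (finite_net_points n) => h [].
- by exists 1; split=> //; exact: net_points1.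
exists (a, b); last by rewrite ax bx.
split=> //=; first exact: le_lt_trans ax bx.
move=> h hn /andP[ah hb]; have [hx|xh] := leP h x.
  by have := ua h (conj hn hx); rewrite leNgt ah.
by have := ub h (conj hn xh); rewrite leNgt hb.
Qed.

Lemma net_interval_left n x : 0 < x <= 1 ->
  exists2 D, net_interval S n D & D.1 < x <= D.2.
Proof.
move=> /andP[x0 x1].
have [||a [an ax] ua] := @finite_set_max R [set h | net_points S n h /\ h < x].
- by apply: sub_finite_set (finite_net_points n) => h [].
- by exists 0; split=> //; exact: net_points0.
have [||b [bn bx] ub] := @finite_set_min R [set h | net_points S n h /\ x <= h].
- by apply: sub_finite_set (finite_net_points n) => h [].
- by exists 1; split=> //; exact: net_points1.
exists (a, b); last by rewrite ax bx.
split=> //=; first exact: lt_le_trans ax bx.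
move=> h hn /andP[ah hb]; have [xh|hx] := leP x h.
  by have := ub h (conj hn xh); rewrite leNgt hb.
by have := ua h (conj hn hx); rewrite leNgt ah.
Qed.

Lemma net_interval_lt n D : net_interval S n D -> D.1 < D.2.
Proof. by case. Qed.

Lemma net_interval_01 n D : net_interval S n D -> 0 <= D.1 /\ D.2 <= 1.
Proof. by move=> [/net_points_01/andP[? _] /net_points_01/andP[_ ?] _ _]. Qed.

Lemma net_interval0 : net_interval S 0 (0, 1).
Proof.
split=> //=; [exact: net_points0|exact: net_points1|].
move=> h /net_pointsP[u [/= -> /= [<-|<-]]] /andP[]; first by rewrite ltxx.
by rewrite ltxx.
Qed.

Lemma itv_of_sub D a b : D.1 < D.2 -> itv_of D `<=` `[a, b] <-> a <= D.1 /\ D.2 <= b.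
Proof.
move=> D12; split=> [h|[a1 b2] x /=]; last first.
  rewrite /itv_of /= !in_itv /= => /andP[l r].
  by rewrite (le_trans a1 l) (le_trans r b2).
have /h : itv_of D D.1 by rewrite /itv_of /= in_itv /= lexx ltW.
have /h : itv_of D D.2 by rewrite /itv_of /= in_itv /= lexx ltW.
by rewrite /= !in_itv /= => /andP[_ ->] /andP[->].
Qed.

Lemma itv_of_sub_cell D u : D.1 < D.2 ->
  itv_of D `<=` cell u <-> word_map u 0 <= D.1 /\ D.2 <= word_map u 1.
Proof. by move=> D12; rewrite cellE; exact: itv_of_sub. Qed.

Lemma net_point_out n N h D : (n <= N)%N -> net_points S n h -> net_interval S N D ->
  h <= D.1 \/ D.2 <= h.
Proof.
move=> nN /(net_points_sub _ _ _ nN) hN [_ _ _ /(_ h hN) D12].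
have [?|h1] := leP h D.1; first by left.
by have [?|h2] := leP D.2 h; [right|case: D12; rewrite h1 h2].
Qed.

Lemma level_net_points0 n u : level_words n u -> net_points S n (word_map u 0).
Proof. by left; exists u. Qed.

Lemma level_net_points1 n u : level_words n u -> net_points S n (word_map u 1).
Proof. by right; exists u. Qed.

(** The endpoints of the cell are net points of level [N] too, hence outside the interior of [D]: a
    cell that meets this interior contains all of [D]. *)
Lemma cell_sup_net n N u D : (n <= N)%N -> level_words n u -> net_interval S N D ->
  word_map u 0 < D.2 -> D.1 < word_map u 1 -> itv_of D `<=` cell u.
Proof.
move=> nN un DN u0 u1; rewrite itv_of_sub_cell; last exact: net_interval_lt DN.
have [?|] := net_point_out _ _ _ _ nN (level_net_points0 _ _ un) DN; last by rewrite leNgt u0.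
have [|?//] := net_point_out _ _ _ _ nN (level_net_points1 _ _ un) DN.
by rewrite leNgt u1.
Qed.

Lemma net_interval_sup n N D : (n <= N)%N -> net_interval S N D ->
  exists2 D', net_interval S n D' & itv_of D `<=` itv_of D'.
Proof.
move=> nN DN; have D12 := net_interval_lt _ _ DN; have [D0 D1] := net_interval_01 _ _ DN.
have [|D' Dn /andP[l r]] := net_interval_right n D.1.
  by rewrite D0 (lt_le_trans D12).
exists D' => //; apply/itv_of_sub => //; split=> //.
have [_ Dn2 _ _] := Dn.
have [|//] := net_point_out _ _ _ _ nN Dn2 DN.
by rewrite leNgt r.
Qed.

Lemma net_interval_sub n N D x : (n <= N)%N -> net_interval S n D -> itv_of D x ->
  exists D', [/\ net_interval S N D', itv_of D' `<=` itv_of D & itv_of D' x].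
Proof.
move=> nN Dn; rewrite /itv_of /= in_itv /= => /andP[x1 x2].
have D12 := net_interval_lt _ _ Dn; have [D0 D1] := net_interval_01 _ _ Dn.
have [Dn1 Dn2 _ _] := Dn.
have [xD|] := ltP x D.2.
  have [|D' DN /andP[l r]] := net_interval_right N x.
    by rewrite (le_trans D0) //= (lt_le_trans xD).
  exists D'; split=> //; last by rewrite in_itv /= l ltW.
  apply/itv_of_sub; first exact: net_interval_lt DN.
  have [?|] := net_point_out _ _ _ _ nN Dn1 DN; last by rewrite leNgt (le_lt_trans x1).
  have [|?//] := net_point_out _ _ _ _ nN Dn2 DN; rewrite leNgt.
  by rewrite (le_lt_trans l).
move=> xD; have {x1 x2 xD} -> : x = D.2 by apply/eqP; rewrite eq_le x2.
have [|D' DN /andP[l r]] := net_interval_left N D.2.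
  by rewrite D1 (le_lt_trans D0).
exists D'; split=> //; last by rewrite in_itv /= r ltW.
apply/itv_of_sub; first exact: net_interval_lt DN.
have [?|] := net_point_out _ _ _ _ nN Dn1 DN; last by rewrite leNgt (lt_le_trans D12).
have [|?//] := net_point_out _ _ _ _ nN Dn2 DN; rewrite leNgt.
by rewrite l.
Qed.

(** * The masses [P_net] *)

Lemma P_netE n D : P_net S n D = level_mass n [set u : word S | itv_of D `<=` cell u].
Proof. by []. Qed.

Lemma cell_prefix n N u : cell u `<=` cell (level_prefix n u).
Proof.
have [w e] := level_prefixP n u; rewrite !cellE [in X in X `<=` _]e => x /=; rewrite !in_itv /=.
move=> /andP[h0 h1]; rewrite (le_trans (word_map_prefix0 _ w)) //.
by rewrite (le_trans h1) // word_map_prefix1.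
Qed.

(** A cell over [D'] has an ancestor of level [n] that meets the interior of [D] and therefore
    contains [D]. *)
Lemma P_net_sub n N D D' : (n <= N)%N -> net_interval S n D -> net_interval S N D' ->
  itv_of D' `<=` itv_of D -> P_net S N D' <= P_net S n D.
Proof.
move=> nN Dn DN D'D; rewrite !P_netE; apply: le_level_mass => // u uN /= D'u.
have D12 := net_interval_lt _ _ Dn; have D12' := net_interval_lt _ _ DN.
have := subset_trans D'u (cell_prefix n N u).
rewrite itv_of_sub_cell // => -[l r].
have /itv_of_sub[//|l' r'] := D'D.
apply: (@cell_sup_net n n) => //.
- exact: level_prefix_le nN uN.
- by rewrite (le_lt_trans l) // (lt_le_trans D12').
- by rewrite (lt_le_trans _ r) // (le_lt_trans l').
Qed.

Lemma level_mass_gt0 n (A : set (word S)) u : level_words n u -> A u -> 0 < level_mass n A.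
Proof.
move=> un Au; rewrite /level_mass (fsbigD1 u) //=; last first.
  by apply: sub_finite_set (finite_level_words n) => v [].
apply: ltr_pwDl; first exact: word_weight_gt0.
by apply: sumr_ge0 => v _; exact/ltW/word_weight_gt0.
Qed.

Lemma P_net_gt0 n D : net_interval S n D -> 0 < P_net S n D.
Proof.
move=> Dn; have D12 := net_interval_lt _ _ Dn; have [D0 D1] := net_interval_01 _ _ Dn.
have [u un /andP[u0 u1]] : exists2 u : word S, level_words n u &
    word_map u 0 <= (D.1 + D.2) / 2 <= word_map u 1.
  by apply: level_cover; lra.
apply: (level_mass_gt0 _ _ _ un); apply: (@cell_sup_net n n) => //; lra.
Qed.

(** * The measure of a set compared with masses of words *)

Lemma fine_mu_out E : measurable E -> (forall x, 0 <= x <= 1 -> ~ E x) -> fine (mu E) = 0.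
Proof.
move=> mE hE; suff -> : mu E = 0%E by [].
apply/negligibleP => //; apply: negligibleS msuppC_null => x Ex.
rewrite mu_supp /= in_itv /= => x01; exact: hE Ex.
Qed.

Lemma fine_mu_in E : measurable E -> (forall x, 0 <= x <= 1 -> E x) -> fine (mu E) = 1.
Proof.
move=> mE hE; have := @probability_setC _ _ _ mu _ mE.
have mE' := measurableC mE.
have : fine (mu (~` E)) = 0.
  by apply: fine_mu_out => // x /hE Ex; apply.
move=> h /(congr1 fine); rewrite h fineB ?fin_num_measure //=.
by move=> /esym/eqP; rewrite subr_eq0 => /eqP.
Qed.

Lemma measurable_word_map u E : measurable E -> measurable (word_map u @^-1` E).
Proof.
move=> mE; rewrite -[X in measurable X]setTI.
have mf : measurable_fun setT (word_map u : measurableTypeR R -> measurableTypeR R).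
  have -> : word_map u = (fun x => r_ u * x + word_map u 0).
    by apply/funext => x; exact: word_mapE.
  by apply: measurable_funD => //; exact: measurable_funM.
exact: mf.
Qed.

(** The share of the word [u] in the measure of [E] when the self-similarity relation is iterated
    along words. *)
Let phi E u := p_ u * fine (mu (word_map u @^-1` E)).

Lemma measure_word_additive E : measurable E -> word_additive (phi E).
Proof.
move=> mE u; rewrite /phi.
have mu' := measurable_word_map u _ mE.
rewrite (mu_self_similar _ mu').
have mj j : measurable (ifs_map S j @^-1` (word_map u @^-1` E)).
  exact: (measurable_word_map [:: j] _ mu').
under eq_bigr => j _ do rewrite -(fineK (fin_num_measure mu _ (mj j))) -EFinM.
rewrite sumEFin /= mulr_sumr; apply: eq_bigr => j _.
have -> : p_ (rcons u j) = p_ u * weight j.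
  by rewrite -cats1 word_weight_cat; congr (_ * _); rewrite /word_weight big_seq1.
rewrite -mulrA; congr (_ * (_ * fine (mu _))).
by apply/seteqP; split => x /=; rewrite -cats1 word_map_cat.
Qed.

Lemma fine_mu_phi E : fine (mu E) = phi E [::].
Proof. by rewrite /phi /word_weight big_nil mul1r. Qed.

(** A word contributes at most its weight, and nothing if its cell misses [E]. *)
Lemma fine_mu_le_mass n E (A : set (word S)) : measurable E ->
  (forall u x, level_words n u -> 0 <= x <= 1 -> E (word_map u x) -> A u) ->
  fine (mu E) <= level_mass n A.
Proof.
move=> mE hA; have [L hL] := @long_words R S n.
rewrite fine_mu_phi (word_additive_sum _ L _ (measure_word_additive _ mE)) /level_mass.
rewrite (word_additive_level _ _ _ _ weight_word_additive hL) [leRHS]big_mkcond.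
rewrite big_seq [leRHS]big_seq.
apply: ler_sum => v; rewrite mem_all_words => /eqP vL.
have pn : level_words n (level_prefix n v) by apply: level_prefix_level; rewrite hL ?vL.
have p0 := ltW (word_weight_gt0 v).
rewrite cat0s /phi; case: asboolP => [_|nA].
  by rewrite ler_piMr // fine_mu_le1 //; exact: measurable_word_map.
rewrite fine_mu_out ?mulr0 //; first exact: measurable_word_map.
move=> x x01 /= Ex; apply: nA; have [w e] := level_prefixP n v.
apply: (hA _ (word_map w x)) => //; first exact: word_map_01.
by rewrite -word_map_cat -e.
Qed.

(** A word whose cell lies in [E] contributes its full weight. *)
Lemma mass_le_fine_mu n E (A : set (word S)) : measurable E ->
  (forall u, level_words n u -> A u -> cell u `<=` E) ->
  level_mass n A <= fine (mu E).
Proof.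
move=> mE hA; have [L hL] := @long_words R S n.
rewrite fine_mu_phi (word_additive_sum _ L _ (measure_word_additive _ mE)) /level_mass.
rewrite (word_additive_level _ _ _ _ weight_word_additive hL) big_mkcond big_seq [leRHS]big_seq.
apply: ler_sum => v; rewrite mem_all_words => /eqP vL.
have pn : level_words n (level_prefix n v) by apply: level_prefix_level; rewrite hL ?vL.
have p0 := ltW (word_weight_gt0 v).
rewrite cat0s /phi; case: asboolP => [Av|_]; last by rewrite mulr_ge0 // fine_mu_ge0.
rewrite fine_mu_in ?mulr1 //; first exact: measurable_word_map.
move=> x x01 /=; apply: (hA _ pn Av).
have [w e] := level_prefixP n v; exists (word_map w x); last by rewrite -word_map_cat -e.
by rewrite /= in_itv /=; exact: word_map_01.
Qed.

(** * Consequences of generalized regularity *)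

Lemma net_interval_inj n D D' x : net_interval S n D -> net_interval S n D' ->
  D'.1 < x < D'.2 -> itv_of D x -> D = D'.
Proof.
move=> Dn Dn' /andP[x1 x2]; rewrite /itv_of /= in_itv /= => /andP[d1 d2].
have out := net_point_out _ _ _ _ (leqnn n).
have [n1 n2 _ _] := Dn; have [n1' n2' _ _] := Dn'.
have a1 : D.1 <= D'.1 by have [//|] := out _ _ n1 Dn'; lra.
have a2 : D'.2 <= D.2 by have [|//] := out _ _ n2 Dn'; lra.
have b1 : D'.1 <= D.1 by have [//|] := out _ _ n1' Dn; lra.
have b2 : D.2 <= D'.2 by have [|//] := out _ _ n2' Dn; lra.
have e1 : D.1 = D'.1 by lra.
have e2 : D.2 = D'.2 by lra.
by rewrite (surjective_pairing D) (surjective_pairing D') e1 e2.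
Qed.

Lemma Gamma_left_ge0 N D n : 0 <= Gamma_left S N D n.
Proof. by apply: sumr_ge0 => w _; exact/ltW/word_weight_gt0. Qed.

Lemma Gamma_right_ge0 N D n : 0 <= Gamma_right S N D n.
Proof. by apply: sumr_ge0 => w _; exact/ltW/word_weight_gt0. Qed.

Lemma Gamma_ge0 N D n : 0 <= Gamma S N D n.
Proof. by rewrite addr_ge0 ?Gamma_left_ge0 ?Gamma_right_ge0. Qed.

(** At the midpoint of [D'] there is a single net interval of level [N + n], so the minimality
    clause of [Q_at] is met by [D'] itself. *)
Lemma P_net_ratio_le_Q_sup n N D D' : net_interval S N D -> net_interval S (N + n) D' ->
  itv_of D' `<=` itv_of D ->
  ((P_net S N D / P_net S (N + n) D')%:E <= Q_sup S mu n)%E.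
Proof.
move=> DN DN' D'D; pose x := (D'.1 + D'.2) / 2.
have D12' := net_interval_lt _ _ DN'.
have xD' : D'.1 < x < D'.2 by rewrite /x; lra.
have xI : itv_of D' x by move: xD'; rewrite /itv_of /= in_itv /=; lra.
apply: (@le_trans _ _ (Q_at S n x)); last first.
  apply: ereal_sup_ubound; exists x => //; rewrite mu_supp /= in_itv /=.
  have [D0 D1] := net_interval_01 _ _ DN'; lra.
apply: ereal_sup_ubound; exists N, D, D'; split => //.
  by split=> //; exact: D'D.
by move=> D'' [[DN'' xD''] _]; rewrite (net_interval_inj _ _ _ _ DN'' DN' xD' xD'').
Qed.

(** From some level on the product in the regularity condition is below 1. Its two suprema are taken
    separately, so the edge paths may belong to an interval [E] unrelated to [D]. *)
Lemma regular_bound (q : R) : 1 < q -> exists2 n0, (0 < n0)%N &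
  forall n N M D D' (E : R * R), (n0 <= n)%N ->
    net_interval S N D -> net_interval S (N + n) D' -> itv_of D' `<=` itv_of D ->
    net_interval S M E ->
    P_net S N D * Gamma S M E n <= q ^+ n * P_net S (N + n) D'.
Proof.
move=> q1; have q0 : 0 < q by lra.
have [n0 _ h] : \forall n \near \oo, (Q_sup S mu n * (q ^- n)%:E * Gamma_sup S n < 1%:E)%E.
  have := mu_regular _ q1 [set z | (z < 1%:E)%E]; apply.
  by apply: open_nbhs_nbhs; split; [exact: open_ereal_lt_ereal | rewrite /= lte_fin ltr01].
(* The successor makes the threshold positive, so that later a single step of one level counts as
   short. *)
exists n0.+1 => // n N M D D' E n0n DN DN' D'D EM.
have P0' := P_net_gt0 _ _ DN'.
have P0 := P_net_gt0 _ _ DN.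
have qn : 0 < q ^+ n by rewrite exprn_gt0.
suff : P_net S N D / P_net S (N + n) D' * q ^- n * Gamma S M E n <= 1.
  rewrite mulrAC -mulrA mulrCA -mulrA -invfM mulrA ler_pdivrMr ?mulr_gt0 // mul1r.
  by rewrite [leLHS]mulrC [q ^+ n * _]mulrC.
rewrite -lee_fin; apply: le_trans (ltW (h n (ltnW n0n))).
rewrite EFinM EFinM; apply: lee_pmul.
- by rewrite -EFinM lee_fin mulr_ge0 // ?divr_ge0 ?invr_ge0 // ltW.
- by rewrite lee_fin Gamma_ge0.
- apply: lee_pmul; rewrite ?lee_fin ?divr_ge0 ?invr_ge0 ?(ltW qn) ?(ltW P0) ?(ltW P0') //.
  exact: P_net_ratio_le_Q_sup.
- by apply: ereal_sup_ubound; exists M, E.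
Qed.

(** Over the root interval the word [u] of a path is empty, so every level word whose cell starts at
    0 is a left-edge path. *)
Lemma Gamma_root n : level_mass n [set u : word S | word_map u 0 = 0] <= Gamma S 0 (0, 1) n.
Proof.
rewrite /Gamma -[leLHS]addr0 lerD ?Gamma_right_ge0 // /Gamma_left /level_mass.
suff -> : [set w | is_path 0 (0, 1) n w /\ word_map w 0 = 0] =
    [set u : word S | level_words n u /\ word_map u 0 = 0] by [].
apply/seteqP; split => [w [[D' [u [_ u0 _ uwn _]]] w0]|w [wn w0]].
  by split => //; move: uwn; rewrite u0.
split=> //; have [|D' DN /andP[l r]] :=
    net_interval_right n (word_map w 0).
  rewrite (word_map0_ge0) //=.
  exact: lt_le_trans (word_map01_lt w) (word_map1_le1 w).
exists D', [::]; split => //.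
- split => //; apply/itv_of_sub; first exact: net_interval_lt DN.
  exact: net_interval_01 DN.
- by move=> x; rewrite cellE.
- rewrite cat0s; apply: (cell_sup_net _ _ _ _ (leqnn n) wn DN) => //.
  exact: le_lt_trans l (word_map01_lt w).
Qed.

Lemma Gamma_root_gt0 n : 0 < Gamma S 0 (0, 1) n.
Proof.
apply: lt_le_trans (Gamma_root n).
have [k kn] := level_extend 0 n [::] ord0 (leq0n n) erefl.
by apply: (level_mass_gt0 _ _ _ kn); exact: word_map_nseq0.
Qed.

(** Covers the short steps, to which [regular_bound] does not apply: descend further, to the fixed
    depth [m], where it does, and use that [P_net] decreases under refinement. The factor [Gamma] of
    the root at depth [m] is a positive constant. *)
Lemma P_net_ratio_bounded n0 (q : R) : 1 < q -> exists2 K : R, 0 < K &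
  forall n N D D', (n <= n0)%N ->
    net_interval S N D -> net_interval S (N + n) D' -> itv_of D' `<=` itv_of D ->
    P_net S N D <= K * P_net S (N + n) D'.
Proof.
move=> q1; have [n1 _ reg] := regular_bound _ q1.
pose m := maxn n0 n1; pose G := Gamma S 0 (0, 1) m.
have G0 : 0 < G by exact: Gamma_root_gt0.
have q0 : 0 < q by lra.
exists (q ^+ m / G) => [|n N D D' nn0 DN DN' D'D]; first by rewrite divr_gt0 // exprn_gt0.
have nm : (n <= m)%N by rewrite (leq_trans nn0) // leq_maxl.
have mD' : itv_of D' D'.1.
  by rewrite /itv_of /= in_itv /= lexx ltW // (net_interval_lt _ _ DN').
have Nnm : (N + n <= N + m)%N by rewrite leq_add2l.
have [D'' [DN'' D''D' _]] :=
  net_interval_sub _ _ _ _ Nnm DN' mD'.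
have le1 := P_net_sub _ _ _ _ Nnm DN' DN'' D''D'.
rewrite -mulrA mulrCA mulrC ler_pdivlMr //.
apply: (le_trans (reg m N 0 D D'' (0, 1) _ DN DN'' _ _)).
- exact: leq_maxr.
- exact: subset_trans D''D' D'D.
- exact: net_interval0.
- by rewrite ler_pM2l // exprn_gt0.
Qed.

(** * Mass of the cells with a prescribed endpoint *)

(** The flag treats both sides at once: [true] stands for right-edge paths and right endpoints,
    [false] for left ones. *)
Definition edge_paths (b : bool) N D n : set (word S) :=
  [set w | is_path N D n w /\ word_map w (if b then 1 else 0) = (if b then 1 else 0)].

Lemma finite_edge_paths b N D n : finite_set (edge_paths b N D n).
Proof.
apply: sub_finite_set (finite_image (fun z : word S * word S => drop (size z.2) z.1)
  (finite_setX (finite_level_words (N + n)) (finite_level_words N))).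
move=> w [[D' [u [_ uN _ uwN _]]] _]; exists (u ++ w, u); first by [].
by rewrite /= drop_size_cat.
Qed.

Lemma edge_paths_le_Gamma b N D n : \sum_(w \in edge_paths b N D n) p_ w <= Gamma S N D n.
Proof.
by case: b; [rewrite /Gamma lerDr Gamma_left_ge0 | rewrite /Gamma lerDl Gamma_right_ge0].
Qed.

(** The point [y] is interior to the root and an endpoint at level [N]. At the first level where it
    is not interior, the ancestor still contains the cell of [u], so [y] is its endpoint on the same
    side. *)
Lemma level_prefix_chain b N u y : level_words N u -> 0 < y < 1 ->
  word_map u (if b then 1 else 0) = y ->
  exists2 j, (j < N)%N &
    word_map (level_prefix j u) 0 < y < word_map (level_prefix j u) 1 /\
    word_map (level_prefix j.+1 u) (if b then 1 else 0) = y.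
Proof.
move=> uN y01 uy.
pose P j := word_map (level_prefix j u) 0 < y < word_map (level_prefix j u) 1.
have P0 : P 0%N.
  have u0 : level_words 0 (level_prefix 0 u) by exact: level_prefix_le uN.
  by rewrite /P u0.
have PN : ~~ P N.
  by rewrite /P level_prefix_id // -uy; case: (b) => /=; rewrite ltxx ?andbF.
have exP : exists j, ~~ P j by exists N.
case: (ex_minnP exP) => -[|j] nPj hj; first by rewrite P0 in nPj.
have jN : (j < N)%N by exact: hj.
exists j => //; have Pj : P j by apply: contraT => /hj; rewrite ltnn.
split=> //; move: nPj; rewrite /P.
have [w e] := level_prefixP j.+1 u.
have l := word_map_prefix0 (level_prefix j.+1 u) w.
have r := word_map_prefix1 (level_prefix j.+1 u) w.
rewrite -e in l r; have lr := word_map01_lt u.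
move: uy; case: (b) => /= uy; lra.
Qed.

(** The counted cells all lie on one side of [y], the side of [D1], whereas [D2] may lie on the
    other. The comparison passes through the last ancestor with [y] in its interior, which covers
    both sides. *)
Lemma level_edge_mass (q : R) b : 1 < q -> exists2 C : R, 0 < C &
  forall N y D1 D2, 0 < y < 1 -> net_interval S N D1 -> net_interval S N D2 ->
    (if b then D1.2 else D1.1) = y -> itv_of D2 y ->
    level_mass N [set u : word S | word_map u (if b then 1 else 0) = y] <=
    C * q ^+ N * P_net S N D2.
Proof.
move=> q1; have q0 : 0 < q by lra.
have [n0 n0_gt0 reg] := regular_bound _ q1.
have [K K0 PK] := P_net_ratio_bounded n0 _ q1.
(* [K] comes from the short steps, [1 / (q - 1)] from summing a geometric series over the splitting
   level [j]. *)
exists (K / (q - 1)) => [|N y D1 D2 y01 DN1 DN2 D1y D2y].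
  by rewrite divr_gt0 // subr_gt0.
have P0 := P_net_gt0 _ _ DN2.
pose A (j : 'I_N) := [set u : word S | [/\ word_map u (if b then 1 else 0) = y,
  word_map (level_prefix j u) 0 < y < word_map (level_prefix j u) 1 &
  word_map (level_prefix j.+1 u) (if b then 1 else 0) = y]].
have D12 := net_interval_lt _ _ DN2.
have interior_mass j D : net_interval S j D -> itv_of D y ->
    level_mass j [set u : word S | word_map u 0 < y < word_map u 1] <= P_net S j D.
  move=> Dj; rewrite /itv_of /= in_itv /= => /andP[Dy yD].
  rewrite P_netE; apply: le_level_mass => // u uj /= /andP[uy yu].
  rewrite level_prefix_id //; apply: (cell_sup_net _ _ _ _ (leqnn j)) => //.
    exact: lt_le_trans uy yD.
  exact: le_lt_trans Dy yu.
have A_mass (j : 'I_N) : level_mass N (A j) <= K * q ^+ (N - j.+1) * P_net S N D2.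
  set n := (N - j.+1)%N; have jN : (j <= N)%N := ltnW (ltn_ord j).
  have eN : N = (j.+1 + n)%N by rewrite /n subnKC.
  have eN' : N = (j + n.+1)%N by rewrite addnS -addSn.
  have [Dj Dj_net D2Dj] := net_interval_sup _ _ _ jN DN2.
  have qn1 : 1 <= q ^+ n by rewrite exprn_ege1 // ltW.
  (* If fewer than [n0] levels follow level [j + 1], the whole descent from [j] to [N] has at most
     [n0] steps, and the short-step bound suffices. *)
  have [n0n|nn0] := leqP n0 n; last first.
    apply: (@le_trans _ _ (P_net S j Dj)).
      apply: le_trans (interior_mass _ _ Dj_net (D2Dj _ D2y)).
      by apply: le_level_mass => // u uN [].
    have DN2' : net_interval S (j + n.+1) D2 by rewrite -eN'.
    apply: (le_trans (PK n.+1 _ _ _ nn0 Dj_net DN2' D2Dj)).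
    by rewrite -eN' ler_pM2r // ler_peMr // ltW.
  (* [Di] lies above [D2] and carries the ratio of masses; [E] lies above [D1] and carries the edge
     paths. *)
  have [Di Di_net D2Di] := net_interval_sup _ _ _ (ltn_ord j) DN2.
  have [E E_net D1E] := net_interval_sup _ _ _ (ltn_ord j) DN1.
  have DiDj : itv_of Di `<=` itv_of Dj.
    have D2lt := net_interval_lt _ _ DN2.
    have /itv_of_sub[//|l2 r2] := D2Dj; have /itv_of_sub[//|l3 r3] := D2Di.
    have Dilt := net_interval_lt _ _ Di_net.
    have [dj1 dj2 _ _] := Dj_net.
    apply/itv_of_sub => //; split.
      by have [//|] := net_point_out _ _ _ _ (leqnSn j) dj1 Di_net; lra.
    by have [|//] := net_point_out _ _ _ _ (leqnSn j) dj2 Di_net; lra.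
  pose B := [set u : word S | word_map (level_prefix j u) 0 < y < word_map (level_prefix j u) 1].
  have massB : level_mass j.+1 B <= K * P_net S j.+1 Di.
    apply: (@le_trans _ _ (P_net S j Dj)).
      apply: le_trans (interior_mass _ _ Dj_net (D2Dj _ D2y)).
      by apply: le_level_mass => // u uN [].
    have := PK 1%N j Dj Di n0_gt0 Dj_net; rewrite addn1; exact.
  have G0 : 0 <= Gamma S j.+1 E n := Gamma_ge0 _ _ _.
  apply: (@le_trans _ _ (level_mass j.+1 B * Gamma S j.+1 E n)); last first.
    apply: (le_trans (ler_wpM2r G0 massB)); rewrite -!mulrA ler_pM2l //.
    have DN2' : net_interval S (j.+1 + n) D2 by rewrite -eN.
    by have := reg _ _ _ _ _ E n0n Di_net DN2' D2Di E_net; rewrite -eN.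
  apply: le_trans (ler_wpM2l (level_mass_ge0 _ _) (edge_paths_le_Gamma b _ _ _)).
  apply: level_mass_concat; first exact: finite_edge_paths.
  move=> u uN [uy yI pu].
  have [w e] := level_prefixP j.+1 u; exists (level_prefix j.+1 u), w.
  have pj : level_words j.+1 (level_prefix j.+1 u) := level_prefix_le _ _ _ (ltn_ord j) uN.
  have D1u : itv_of D1 `<=` cell u.
    have D1lt := net_interval_lt _ _ DN1; have ult := word_map01_lt u.
    by apply: (cell_sup_net _ _ _ _ (leqnn N)) => //; move: uy D1y; case: (b) => /=; lra.
  split => //.
    rewrite /B /= level_prefix_trans //; have [uN' _] := (level_wordsP N u).1 uN.
    exact: le_trans uN' (min_ratio_exp_le _ _ (ltn_ord j)).
  split; last first.
    apply/eqP; rewrite -(word_map_eq (level_prefix j.+1 u)) -word_map_cat -e uy.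
    by rewrite pu.
  (* [D1] witnesses the path: it lies in the cell of [u] and in [E], so the ancestor at level
     [j + 1] meets the interior of [E] and contains [E]. *)
  exists D1, (level_prefix j.+1 u); rewrite -e -eN; split => //.
  have D1lt := net_interval_lt _ _ DN1.
  have /itv_of_sub[//|l r] := D1E.
  have := subset_trans D1u (cell_prefix j.+1 N u); rewrite itv_of_sub_cell // => -[l' r'].
  apply: (cell_sup_net _ _ _ _ (leqnn j.+1)) => //; lra.
apply: (@le_trans _ _ (\sum_(j < N) level_mass N (A j))).
  apply: level_mass_bigcup => u uN uy.
  have [j jN [yI uj]] := level_prefix_chain _ _ _ _ uN y01 uy.
  by exists (Ordinal jN).
apply: (le_trans (ler_sum _ (fun j _ => A_mass j))).
rewrite -mulr_suml ler_pM2r // -mulr_sumr -mulrA ler_pM2l //.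
rewrite mulrC ler_pdivlMr ?subr_gt0 // mulrC.
(* Reversing the order turns the exponents [N - (j + 1)] into [j]. *)
rewrite (reindex_inj rev_ord_inj) /=.
have -> : \sum_(j < N) q ^+ (N - (N - j.+1).+1) = \sum_(j < N) q ^+ j.
  by apply: eq_bigr => j _; rewrite subnSK // subKn // ltnW.
by rewrite -subrX1 gerBl.
Qed.

(** * Balls compared with net intervals, by the gap condition *)

(** Cells of level [L] are no longer than [lam ^+ L < r], so those containing [x] lie in the
    ball. *)
Lemma net_interval_ball_mass L D x (r : R) : net_interval S L D -> itv_of D x ->
  lam ^+ L < r -> P_net S L D <= fine (mu (ball x r)).
Proof.
move=> DL xD Lr; apply: mass_le_fine_mu; first exact: measurableR_ball.
move=> u /level_wordsP[uL _] /= Du z; have := Du _ xD.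
rewrite cellE /ball /= !in_itv /= (word_mapE u 1) mulr1 => /andP[x1 x2] /andP[z1 z2].
by rewrite ltr_distlC; apply/andP; split; lra.
Qed.

Variable f : nat -> R.
Hypothesis f_gt0 : forall n, 0 < f n.
Hypothesis f_gap : forall n u w (z : R), level_words n u -> level_words n w ->
  z = 0 \/ z = 1 -> word_map u z <> word_map w z ->
  f n * lam ^+ n <= `|word_map u z - word_map w z|.

(** Some word of zeros belongs to level [n] and starts at 0. By the gap condition a cell that meets
    the ball cannot start at any other point. *)
Lemma ball0_mass_le_Gamma n : fine (mu (ball 0 (f n * lam ^+ n))) <= Gamma S 0 (0, 1) n.
Proof.
apply: le_trans (Gamma_root n); apply: fine_mu_le_mass; first exact: measurableR_ball.
move=> u x un /andP[x0 x1]; rewrite /ball /= ltr_distlC => /andP[_ ux].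
have u0 := word_map0_ge0 u.
have u0x : word_map u 0 <= word_map u x by rewrite word_map_le.
have [k kn] := level_extend 0 n [::] ord0 (leq0n n) erefl.
apply/eqP; apply: contraT => /eqP; rewrite -[X in _ <> X -> _](word_map_nseq0 k).
move=> /(f_gap _ _ _ _ un kn (or_introl erefl)); rewrite /= word_map_nseq0 subr0 ger0_norm //.
lra.
Qed.

(** The left endpoints counted lie within less than [rho] of each other, so by the gap condition
    they are a single point [y], and [level_edge_mass] bounds the mass by [P_net] of the interval
    [E2] ending at [y]. *)
Lemma right_mass_bound (q : R) : 1 < q -> exists2 C : R, 0 < C &
  forall M D x (rho : R), net_interval S M D -> itv_of D x -> rho <= f M * lam ^+ M ->
    level_mass M [set u : word S | D.2 <= word_map u 0 < x + rho] <=
    C * q ^+ M * P_net S M D.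
Proof.
move=> q1; have [C C0 edge] := level_edge_mass _ false q1.
exists C => // M D x rho DM; rewrite /itv_of /= in_itv /= => /andP[xD1 xD2] rhoM.
have q0 : 0 < q by lra.
have PD := P_net_gt0 _ _ DM; have D12 := net_interval_lt _ _ DM.
have [D0 D1] := net_interval_01 _ _ DM.
have [[u0 [u0M /andP[yD yx]]]|none] := pselect (exists u : word S,
    level_words M u /\ (D.2 <= word_map u 0 < x + rho)); last first.
  rewrite /level_mass fsbig1; first by rewrite !mulr_ge0 ?exprn_ge0 // ltW.
  by move=> u [uM uD]; case: none; exists u.
set y := word_map u0 0 in yD yx.
have y01 : 0 < y < 1.
  have := word_map01_lt u0; have := word_map1_le1 u0; rewrite -/y; lra.
have [|E1 E1M /andP[l1 r1]] := net_interval_right M y; first by lra.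
have [|E2 E2M /andP[l2 r2]] := net_interval_left M y; first by lra.
have E1y : E1.1 = y.
  have [] := net_point_out _ _ _ _ (leqnn M) (level_net_points0 _ _ u0M) E1M; rewrite -/y; lra.
have yE2 : itv_of E2 y by rewrite /itv_of /= in_itv /=; lra.
apply: (@le_trans _ _ (C * q ^+ M * P_net S M E2)); last first.
  rewrite ler_pM2l ?mulr_gt0 ?exprn_gt0 //; apply: le_level_mass => // u uM /= E2u.
  move: E2u; rewrite itv_of_sub_cell ?(net_interval_lt _ _ E2M) // => -[ul ur].
  rewrite level_prefix_id //; apply: (cell_sup_net _ _ _ _ (leqnn M)) => //; last by lra.
  (* A cell containing [E2] starts strictly before [y], hence by the gap condition at least [rho]
     before it, which is to the left of [x]. As it reaches [y], it contains [D]. *)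
  have uy : word_map u 0 <> word_map u0 0 by rewrite -/y; lra.
  have := f_gap _ _ _ _ uM u0M (or_introl erefl) uy; rewrite -/y ltr0_norm ?subr_lt0; lra.
apply: le_trans (edge M y E1 E2 y01 E1M E2M E1y yE2).
apply: le_level_mass => // u uM /= /andP[ul ur]; rewrite level_prefix_id //.
apply/eqP; apply: contraT => /eqP uy.
have := f_gap _ _ _ _ uM u0M (or_introl erefl) uy; rewrite -/y.
have : `|word_map u 0 - y| < rho by rewrite ltr_distl; apply/andP; split; lra.
lra.
Qed.

(** Mirror image of [right_mass_bound], with the gap condition for right endpoints. *)
Lemma left_mass_bound (q : R) : 1 < q -> exists2 C : R, 0 < C &
  forall M D x (rho : R), net_interval S M D -> itv_of D x -> rho <= f M * lam ^+ M ->
    level_mass M [set u : word S | x - rho < word_map u 1 <= D.1] <=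
    C * q ^+ M * P_net S M D.
Proof.
move=> q1; have [C C0 edge] := level_edge_mass _ true q1.
exists C => // M D x rho DM; rewrite /itv_of /= in_itv /= => /andP[xD1 xD2] rhoM.
have q0 : 0 < q by lra.
have PD := P_net_gt0 _ _ DM; have D12 := net_interval_lt _ _ DM.
have [D0 D1] := net_interval_01 _ _ DM.
have [[u0 [u0M /andP[xy yD]]]|none] := pselect (exists u : word S,
    level_words M u /\ (x - rho < word_map u 1 <= D.1)); last first.
  rewrite /level_mass fsbig1; first by rewrite !mulr_ge0 ?exprn_ge0 // ltW.
  by move=> u [uM uD]; case: none; exists u.
set y := word_map u0 1 in yD xy.
have y01 : 0 < y < 1.
  have := word_map01_lt u0; have := word_map0_ge0 u0; rewrite -/y; lra.
have [|E1 E1M /andP[l1 r1]] := net_interval_left M y; first by lra.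
have [|E2 E2M /andP[l2 r2]] := net_interval_right M y; first by lra.
have E1y : E1.2 = y.
  have [] := net_point_out _ _ _ _ (leqnn M) (level_net_points1 _ _ u0M) E1M; rewrite -/y; lra.
have yE2 : itv_of E2 y by rewrite /itv_of /= in_itv /=; lra.
apply: (@le_trans _ _ (C * q ^+ M * P_net S M E2)); last first.
  rewrite ler_pM2l ?mulr_gt0 ?exprn_gt0 //; apply: le_level_mass => // u uM /= E2u.
  move: E2u; rewrite itv_of_sub_cell ?(net_interval_lt _ _ E2M) // => -[ul ur].
  rewrite level_prefix_id //; apply: (cell_sup_net _ _ _ _ (leqnn M)) => //; first by lra.
  have uy : word_map u 1 <> word_map u0 1 by rewrite -/y; lra.
  have := f_gap _ _ _ _ uM u0M (or_intror erefl) uy; rewrite -/y gtr0_norm ?subr_gt0; lra.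
apply: le_trans (edge M y E1 E2 y01 E1M E2M E1y yE2).
apply: le_level_mass => // u uM /= /andP[ul ur]; rewrite level_prefix_id //.
apply/eqP; apply: contraT => /eqP uy.
have := f_gap _ _ _ _ uM u0M (or_intror erefl) uy; rewrite -/y.
have : `|word_map u 1 - y| < rho by rewrite ltr_distl; apply/andP; split; lra.
lra.
Qed.

(** A cell meeting the ball contains [D], or starts to the right of its interior, or ends to the
    left of it; each kind has its own bound. *)
Lemma ball_mass_le_net (q : R) : 1 < q -> exists2 C : R, 0 < C &
  forall M D x (rho : R), net_interval S M D -> itv_of D x -> rho <= f M * lam ^+ M ->
    fine (mu (ball x rho)) <= C * q ^+ M * P_net S M D.
Proof.
move=> q1; have q0 : 0 < q by lra.
have [C1 C10 h1] := right_mass_bound _ q1; have [C2 C20 h2] := left_mass_bound _ q1.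
exists (1 + C1 + C2) => [|M D x rho DM xD rhoM]; first by lra.
have PD := P_net_gt0 _ _ DM; have D12 := net_interval_lt _ _ DM.
pose A0 := [set u : word S | itv_of D `<=` cell u].
pose A1 := [set u : word S | D.2 <= word_map u 0 < x + rho].
pose A2 := [set u : word S | x - rho < word_map u 1 <= D.1].
apply: (@le_trans _ _ (level_mass M (A0 `|` (A1 `|` A2)))).
  apply: fine_mu_le_mass; first exact: measurableR_ball.
  move=> u z uM /andP[z0 z1]; rewrite /ball /= ltr_distlC => /andP[zl zr].
  have u0z : word_map u 0 <= word_map u z by rewrite word_map_le.
  have uz1 : word_map u z <= word_map u 1 by rewrite word_map_le.
  have [uD|uD] := leP D.2 (word_map u 0); first by right; left; rewrite /A1 /=; lra.
  have [uD'|uD'] := leP (word_map u 1) D.1; first by right; right; rewrite /A2 /=; lra.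
  by left; exact: (cell_sup_net _ _ _ _ (leqnn M)).
apply: (le_trans (level_massU M _ A0 (A1 `|` A2) _)); first by move=> u _; exact: id.
rewrite -addrA !mulrDl mul1r; apply: lerD.
  by rewrite -/(P_net S M D) ler_peMl ?(ltW PD) // exprn_ege1 // ltW.
apply: (le_trans (level_massU M _ A1 A2 _)); first by move=> u _; exact: id.
by apply: lerD; [exact: h1|exact: h2].
Qed.

(** * From bounds on ratios to exponents *)

Hypothesis f_dec : {homo f : m n / (m <= n)%N >-> n <= m}.
Hypothesis f_subexp : (fun n => ln (f n) / n%:R) @ \oo --> (0 : R).

Lemma min_ratio_div_gt1 (q : R) : 1 < q -> 1 < q / lam.
Proof.
move=> q1; have l0 := min_ratio_gt0 (S := S); have l1 := min_ratio_lt1 (S := S).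
by rewrite ltr_pdivlMr // mul1r; lra.
Qed.

(** Regularity is applied with the edge paths of the root. Their mass is at least that of a ball
    around 0 of radius [c * (lam / q) ^+ n], which the local dimension at 0 bounds from below. Short
    steps go into [K0]. *)
Lemma net_ratio_bound (q s c c0 : R) : 1 < q -> 0 <= s ->
  0 < c <= 1 -> (forall n, c / q ^+ n <= f n) ->
  0 < c0 -> (forall r, 0 < r <= 1 -> c0 * r `^ s <= fine (mu (ball 0 r))) ->
  exists2 K : R, 0 < K & forall n N D D',
    net_interval S N D -> net_interval S (N + n) D' -> itv_of D' `<=` itv_of D ->
    P_net S N D <= K * (q ^+ n * ((q / lam) ^+ n) `^ s) * P_net S (N + n) D'.
Proof.
move=> q1 s0 /andP[c_gt0 c1] cf c00 dim; have q0 : 0 < q by lra.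
have [n0 _ reg] := regular_bound _ q1.
have [K0 K00 PK] := P_net_ratio_bounded n0 _ q1.
have cs0 : 0 < c `^ s by rewrite powR_gt0.
have C0 : 0 < (c0 * c `^ s)^-1 by rewrite invr_gt0 mulr_gt0.
exists (K0 + (c0 * c `^ s)^-1) => [|n N D D' DN DN' D'D]; first by rewrite addr_gt0.
have P0 := P_net_gt0 _ _ DN; have P0' := P_net_gt0 _ _ DN'.
have qn0 : 0 < q ^+ n by rewrite exprn_gt0.
have qn1 : 1 <= q ^+ n by rewrite exprn_ege1 // ltW.
set T := (q / lam) ^+ n.
have T1 : 1 <= T by rewrite exprn_ege1 // ltW // min_ratio_div_gt1.
have T0 : 0 < T by lra.
have Ts1 : 1 <= T `^ s by rewrite -(powRr0 T) ler_powR.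
have QT1 : 1 <= q ^+ n * T `^ s by rewrite mulr_ege1.
have [n0n|nn0] := leqP n0 n; last first.
  apply: (le_trans (PK _ _ _ _ (ltnW nn0) DN DN' D'D)).
  rewrite ler_pM2r // -[leLHS]mulr1 ler_pM //; first exact: ltW.
  by rewrite lerDl ltW.
have := reg n N 0 D D' (0, 1) n0n DN DN' D'D net_interval0.
set G := Gamma S 0 (0, 1) n => PG.
have Gc : c0 * c `^ s <= G * T `^ s.
  have rT : c / T * T = c by rewrite divfK // gt_eqF.
  have r01 : 0 < c / T <= 1.
    by rewrite divr_gt0 //= ler_pdivrMr // mul1r; lra.
  have /andP[r0 _] := r01.
  rewrite -[in leLHS]rT powRM ?(ltW r0) ?(ltW T0) // mulrA ler_pM2r ?powR_gt0 //.
  apply: (le_trans (dim _ r01)); apply: le_trans (ball0_mass_le_Gamma n).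
  apply: fine_mu_le; [exact: measurableR_ball|exact: measurableR_ball|].
  apply: le_ball; rewrite /T expr_div_n invf_div mulrA mulrAC.
  by rewrite ler_pM2r // min_ratio_exp_gt0.
apply: (@le_trans _ _ ((c0 * c `^ s)^-1 * (q ^+ n * T `^ s) * P_net S (N + n) D')); last first.
  by rewrite ler_pM2r // ler_pM2r ?mulr_gt0 ?powR_gt0 // lerDr ltW.
rewrite -mulrA mulrC ler_pdivlMr ?mulr_gt0 //.
apply: (@le_trans _ _ (P_net S N D * (G * T `^ s))); first by rewrite ler_pM2l.
by rewrite mulrA [leRHS]mulrAC ler_pM2r ?powR_gt0.
Qed.

(** The large ball is controlled by the interval [D] of level [M] at [x], [net_ratio_bound] descends
    [n] levels to [D'], and the cells over [D'] fit into the small ball. *)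
Lemma ball_ratio_bound (q s c c0 : R) : 1 < q -> 0 <= s ->
  0 < c <= 1 -> (forall n, c / q ^+ n <= f n) ->
  0 < c0 -> (forall r, 0 < r <= 1 -> c0 * r `^ s <= fine (mu (ball 0 r))) ->
  exists2 K : R, 0 < K & forall x M n (rho r : R), 0 <= x <= 1 ->
    rho <= f M * lam ^+ M -> lam ^+ (M + n) < r ->
    fine (mu (ball x rho)) <=
      K * (q ^+ M * (q ^+ n * ((q / lam) ^+ n) `^ s)) * fine (mu (ball x r)).
Proof.
move=> q1 s0 c01 cf c00 dim; have q0 : 0 < q by lra.
have [K K0 hK] := net_ratio_bound _ _ _ _ q1 s0 c01 cf c00 dim.
have [C C0 hC] := ball_mass_le_net _ q1.
exists (C * K) => [|x M n rho r x01 rhoM rL]; first by rewrite mulr_gt0.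
have [D DM xD] : exists2 D, net_interval S M D & itv_of D x.
  rewrite /itv_of; have /andP[x0 x1] := x01; have [xlt1|x_ge1] := ltP x 1.
    have [|D DM /andP[l r']] := net_interval_right M x; first by rewrite x0.
    by exists D => //=; rewrite in_itv /= l ltW.
  have [|D DM /andP[l r']] := net_interval_left M x; first by lra.
  by exists D => //=; rewrite in_itv /= r' ltW.
have [D' [DM' D'D xD']] := net_interval_sub _ _ _ _ (leq_addr n M) DM xD.
have P0' := P_net_gt0 _ _ DM'.
have T0 : 0 < (q / lam) ^+ n.
  by rewrite exprn_gt0 // (lt_trans ltr01) // min_ratio_div_gt1.
apply: (le_trans (hC _ _ _ _ DM xD rhoM)).
apply: (@le_trans _ _ (C * q ^+ M * (K * (q ^+ n * ((q / lam) ^+ n) `^ s) *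
    P_net S (M + n) D'))).
  by rewrite ler_pM2l ?mulr_gt0 ?exprn_gt0 //; exact: hK.
rewrite [leLHS](_ : _ = C * K * (q ^+ M * (q ^+ n * ((q / lam) ^+ n) `^ s)) *
    P_net S (M + n) D'); last by ring.
rewrite ler_pM2l; first exact: net_interval_ball_mass.
apply: mulr_gt0; first exact: mulr_gt0.
by rewrite mulr_gt0 ?exprn_gt0 // mulr_gt0 ?exprn_gt0 // powR_gt0.
Qed.

Lemma upper_local_dim0_qA_exponent (delta s s' : R) : 0 < delta ->
  (upper_local_dim mu 0 < s%:E)%E -> s < s' -> qA_exponent mu delta s'.
Proof.
move=> delta0 dim0 ss'.
have supp0 : msupp mu 0 by rewrite mu_supp /= in_itv /= lexx ler01.
have [s0 [c0 c00 hdim]] := upper_local_dim_lt _ _ supp0 dim0.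
have l0 := min_ratio_gt0 (S := S); have l1 := min_ratio_lt1 (S := S).
have [|eps eps0 le_s'] := exists_small_exponent _ delta s (s' - s) delta0 s0.
  by rewrite subr_gt0.
rewrite subrKC in le_s'.
have li1 : 1 < lam^-1 by rewrite invf_gt1.
have li0 : 0 < lam^-1 by rewrite invr_gt0.
(* With this [q] every error factor is a power of [a = lam^-M] or [b = lam^-n]. *)
pose q := lam^-1 `^ eps.
have q1 : 1 < q.
  rewrite /q -[ltLHS](_ : 1 `^ eps = 1); last by rewrite powR1.
  by rewrite gt0_ltr_powR // nnegrE ?ler01 // ltW.
have q0 : 0 < q by lra.
have [c c01 cf] := subexponential_lower_bound _ _ _ f_gt0 f_dec f_subexp q1.
have [K K0 hK] := ball_ratio_bound _ _ _ _ q1 s0 c01 cf c00 hdim.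
have /andP[c_gt0 c1] := c01.
(* Since [f M >= c / q ^+ M], the bound [rho <= c * t ^+ M] ensures [rho <= f M * lam ^+ M]; below,
   [M] is the level with [c * t ^+ M] comparable to [rho]. *)
pose t := lam / q.
have t0 : 0 < t by rewrite divr_gt0.
have t1 : t < 1 by rewrite ltr_pdivrMr // mul1r; lra.
pose sigma := eps + (1 + eps) * s.
pose K2 := (c * t * lam)^-1.
have K20 : 0 < K2 by rewrite invr_gt0 mulr_gt0 // mulr_gt0.
exists c, (K * K2 `^ sigma); split => //; first by rewrite mulr_gt0 // powR_gt0.
move=> r rho r0 r_rho rho_le rhoc.
have rrho : r <= rho := le_trans r_rho rho_le.
have rho0 : 0 < rho by lra.
have [M /andP[tM1 tM]] : exists n, t ^+ n.+1 < rho / c <= t ^+ n.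
  by apply: exists_pow_bracket; rewrite ?t0 // divr_gt0 //= ler_pdivrMr // mul1r.
have [k /andP[lk1 lk]] : exists n, lam ^+ n.+1 < r <= lam ^+ n.
  by apply: exists_pow_bracket; rewrite ?l0 // r0 /=; lra.
have qM1 : 1 <= q ^+ M by rewrite exprn_ege1 // ltW.
have qM0 : 0 < q ^+ M by lra.
have lM0 : 0 < lam ^+ M := min_ratio_exp_gt0 M.
have tqM : t ^+ M * q ^+ M = lam ^+ M by rewrite -exprMn divfK // gt_eqF.
have tM0 : 0 < t ^+ M by rewrite exprn_gt0.
have rho_ct : rho <= c * t ^+ M by rewrite mulrC -ler_pdivrMr.
have rho_lM : rho <= lam ^+ M.
  apply: (le_trans rho_ct); rewrite -tqM; nra.
(* Both scales are ordered, [lam ^+ k.+1 < r <= rho <= lam ^+ M], so the truncated subtraction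
   defining [n] is exact. *)
have Mk : (M <= k.+1)%N.
  rewrite leqNgt; apply/negP => /ltnW /(min_ratio_exp_le (S := S)); lra.
pose n := (k.+1 - M)%N; have eMn : (M + n = k.+1)%N by rewrite subnKC.
pose a := lam^-1 ^+ M; pose b := lam^-1 ^+ n.
have a0 : 0 < a by rewrite exprn_gt0.
have b0 : 0 < b by rewrite exprn_gt0.
have qE m : q ^+ m = (lam^-1 ^+ m) `^ eps.
  by rewrite /q powRXn // ltW.
have qnE : q ^+ n * ((q / lam) ^+ n) `^ s = b `^ sigma.
  have -> : (q / lam) ^+ n = b `^ (1 + eps).
    rewrite exprMn qE -/b powRD ?(gt_eqF b0) ?implybT // powRr1 ?(ltW b0) //.
    by rewrite mulrC.
  by rewrite qE -/b -powRrM -powRD // (gt_eqF b0) implybT.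
have X1 : 1 <= rho / r by rewrite ler_pdivlMr // mul1r.
have X0 : 0 < rho / r by lra.
(* Here the separation of the radii enters: [r <= rho ^ (1 + delta)] means
   [rho ^ (- delta) <= rho / r], and [a] is at most [1 / rho]. *)
have aX : a <= (rho / r) `^ delta^-1.
  have a_rho : a <= rho^-1 by rewrite /a exprVn lef_pV2.
  apply: (le_trans a_rho).
  have -> : rho^-1 = (rho^-1 `^ delta) `^ delta^-1.
    by rewrite -powRrM divff ?gt_eqF // powRr1 // invr_ge0 ltW.
  rewrite ge0_ler_powR ?nnegrE ?invr_ge0 ?powR_ge0 ?(ltW delta0) ?(ltW X0) //.
  rewrite ler_pdivlMr //.
  apply: (le_trans (ler_wpM2l (powR_ge0 _ _) r_rho)).
  rewrite powRD ?(gt_eqF rho0) ?implybT // powRr1 ?(ltW rho0) // mulrCA.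
  rewrite -powRM ?invr_ge0 ?(ltW rho0) //.
  by rewrite mulVf ?gt_eqF // powR1 mulr1.
(* [b] is [lam ^+ M / lam ^+ k.+1]. The denominator is at least [lam * r], and the numerator
   [t ^+ M * q ^+ M] is at most [rho * q ^+ M / (c * t)], with [q ^+ M = a ^ eps]. *)
have bX : b <= K2 * (rho / r) * a `^ eps.
  rewrite -qE; have blk : b * lam ^+ k.+1 = lam ^+ M.
    rewrite -eMn exprD mulrCA -exprMn mulVf ?gt_eqF // expr1n mulr1 //.
  have h1 : b * (lam * r) <= lam ^+ M.
    by rewrite -blk ler_pM2l // exprS ler_pM2l.
  have h2 : t ^+ M * (c * t) <= rho.
    rewrite (_ : t ^+ M * (c * t) = t ^+ M.+1 * c); last by rewrite exprSr mulrCA mulrC.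
    by rewrite -ler_pdivlMr // ltW.
  have h3 : b * (lam * r) * (c * t) <= rho * q ^+ M.
    apply: (@le_trans _ _ (lam ^+ M * (c * t))); first by rewrite (ler_pM2r (mulr_gt0 c_gt0 t0)).
    by rewrite -tqM mulrAC ler_pM2r.
  rewrite [leRHS](_ : _ = rho * q ^+ M / (r * (c * t * lam))); last first.
    by rewrite invfM -/K2; ring.
  rewrite ler_pdivlMr; last by rewrite mulr_gt0 // mulr_gt0 // mulr_gt0.
  apply: le_trans h3.
  by rewrite le_eqVlt; apply/orP; left; apply/eqP; ring.
have comb : a `^ eps * b `^ sigma <= K2 `^ sigma * (rho / r) `^ s'.
  by apply: (@powR_combine _ _ _ _ _ _ delta) => //; rewrite (ltW a0, ltW b0).
apply: ge_ereal_sup => _ [x xs <-]; rewrite lee_fin.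
have x01 : 0 <= x <= 1 by move: xs; rewrite mu_supp /= in_itv.
rewrite ler_pdivrMr ?msupp_ball_gt0 //.
have rhoM : rho <= f M * lam ^+ M.
  apply: (le_trans rho_ct); rewrite /t expr_div_n mulrA mulrAC ler_pM2r //.
apply: (le_trans (hK x M n rho r x01 rhoM _)); first by rewrite eMn.
rewrite ler_pM2r ?msupp_ball_gt0 // -mulrA ler_pM2l // qnE qE.
exact: comb.
Qed.

Lemma qA_HE delta : 0 < delta -> qA_H mu delta = upper_local_dim mu 0.
Proof.
move=> delta0.
have supp0 : msupp mu 0 by rewrite mu_supp /= in_itv /= lexx ler01.
apply/eqP; rewrite eq_le; apply/andP; split; last first.
  apply: le_ereal_inf_tmp => _ [s sexp <-].
  exact: upper_local_dim_le_exponent delta0 sexp supp0.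
have key s : (upper_local_dim mu 0 < s%:E)%E -> (qA_H mu delta <= s%:E)%E.
  by move=> ds; apply: qA_H_le => s'; exact: upper_local_dim0_qA_exponent.
case: (upper_local_dim mu 0) (fun s => @upper_local_dim_lt _ mu 0 s supp0) key => [d _|_ _|h _].
- move=> key; apply/lee_addgt0Pr => e e0; apply: key.
  by rewrite lte_fin ltrDl.
- exact: leey.
(* The value [-oo] is impossible: it would lie below -1, whereas [upper_local_dim_lt] forces strict
   upper bounds to be nonnegative. *)
- by have [] := h (-1) (ltNyr _); rewrite ler0N1.
Qed.

End QuasiAssouad.

Theorem theorem5p8 (R : realType) (S : weighted_ifs R)
    (mu : probability (measurableTypeR R) R)
    (attractor01 : is_attractor S `[0, 1]%classic)
    (label_first : ifs_map S ord0 0 = 0)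
    (label_last : ifs_map S ord_max 1 = 1)
    (mu_self_similar : self_similar S mu)
    (mu_supp : msupp mu = `[0, 1]%classic)
    (mu_regular : generalized_regular S mu)
    (gap : asymptotic_gap_wsc S) :
  dim_qA mu = Order.max (upper_local_dim mu 0) (upper_local_dim mu 1) /\
  (* dim_qA mu is the maximum, and not only the supremum, over the support *)
  ([set upper_local_dim mu x | x in msupp mu] (dim_qA mu) /\
   ubound [set upper_local_dim mu x | x in msupp mu] (dim_qA mu)).
Proof.
have [f [f_gt0 f_dec f_subexp f_gap]] := gap.
have supp0 : msupp mu 0 by rewrite mu_supp /= in_itv /= lexx ler01.
have supp1 : msupp mu 1 by rewrite mu_supp /= in_itv /= lexx ler01.
have HE delta : 0 < delta -> qA_H mu delta = upper_local_dim mu 0.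
  exact: (qA_HE mu attractor01 label_first label_last mu_self_similar mu_supp mu_regular
    f f_gt0 f_gap f_dec f_subexp).
have dimE : dim_qA mu = upper_local_dim mu 0.
  apply: lim_near_cst; first exact: ereal_hausdorff.
  near=> delta; apply: HE; near: delta; exact: nbhs_right_gt.
(* [qA_H] takes the same value at every positive [delta], so [delta = 1] serves to compare it with
   the local dimension at [x]. *)
have dim_ge x : msupp mu x -> (upper_local_dim mu x <= dim_qA mu)%E.
  move=> xs; rewrite dimE -(HE 1 ltr01); apply: le_ereal_inf_tmp => _ [s sexp <-].
  exact: upper_local_dim_le_exponent ltr01 sexp xs.
split; last first.
  by split=> [|_ [x xs <-]]; [exists 0; rewrite ?dimE | exact: dim_ge].
(* The local dimension at 1 is at most that at 0, so the maximum equals the value at 0. *)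
have le10 := dim_ge 1 supp1; rewrite dimE in le10.
by have := max_l le10; rewrite dimE => ->.
Unshelve. all: by end_near. Qed.
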